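(* Let $\Omega$ be a connected bounded open subset of $\mathbb{R}^n$ with $C^\infty$ boundary, and let $P=P(x,D)$ be the second order differential operator $$P(x,D)=-\sum_{j,k=1}^n \frac{\partial}{\partial x_j}\,g^{jk}(x)\,\frac{\partial}{\partial x_k}$$ with Dirichlet boundary conditions on $\Omega$, where $(g^{jk})\in C^\infty(\overline{\Omega})$ is real, symmetric and positive definite in $\overline{\Omega}$. Assume that $f\in L^2(\Omega)$ satisfies $\log(2+P)f\in L^2(\Omega)$. Then $$\lim_{R\to\infty}S_R(P)f(x)=f(x)$$ for almost every $x\in\Omega$.
   Context: With Dirichlet boundary conditions, $P$ is the non-negative self-adjoint operator on $L^2(\Omega)$ associated with the closed quadratic form $u\mapsto\int_\Omega\sum_{j,k}g^{jk}\,\partial_k u\,\overline{\partial_j u}\,dx$ with form domain $H^1_0(\Omega)$. Let $E_P$ be its spectral resolution. The spherical partial sums are $S_R(P)f=\int_0^R dE_P(\lambda)f$, i.e. $S_R(P)=\mathbf 1_{[0,R]}(P)$. The spectrum of $P$ is discrete, so $S_R(P)f$ is the finite sum of the orthogonal projections of $f$ onto the eigenspaces of eigenvalues $\le R$; one representative of each such projection is fixed, and $S_R(P)f(x)$ is the corresponding pointwise sum. The condition $\log(2+P)f\in L^2(\Omega)$ means that $f$ is in the domain of the self-adjoint operator $\log(2+P)$. *)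

(* Defs.v *)
From HB Require Import structures.
From mathcomp Require Import all_boot all_order all_algebra.
From mathcomp Require Import complex.
From mathcomp Require Import all_classical all_reals all_analysis.

Set Implicit Arguments.
Unset Strict Implicit.
Unset Printing Implicit Defensive.

Import Order.TTheory GRing.Theory Num.Theory.
Import numFieldNormedType.Exports.

Local Open Scope classical_set_scope.
Local Open Scope ring_scope.
Local Open Scope complex_scope.

(* ['rV[R]_n] carries the sigma-algebra generated by its coordinates, which is
   the Borel sigma-algebra of R^n (same construction as for [n.-tuple R]). *)

Section rV_measurable.
Context {R : realType} (n : nat).

Definition rV_coord (i : 'I_n) (x : 'rV[R]_n) : R := x ord0 i.

Let rV_set0 : g_sigma_preimage rV_coord set0.
Proof. exact: sigma_algebra0. Qed.

Let rV_setC A : g_sigma_preimage rV_coord A -> g_sigma_preimage rV_coord (~` A).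
Proof. exact: sigma_algebraC. Qed.

Let rV_bigcup (F : (set 'rV[R]_n)^nat) :
  (forall i, g_sigma_preimage rV_coord (F i)) ->
  g_sigma_preimage rV_coord (\bigcup_i F i).
Proof. exact: sigma_algebra_bigcup. Qed.

HB.instance Definition _ := @isMeasurable.Build default_measure_display
  'rV[R]_n (g_sigma_preimage rV_coord) rV_set0 rV_setC rV_bigcup.

End rV_measurable.

Lemma measurable_rV_coord {R : realType} (n : nat) (i : 'I_n) :
  measurable_fun [set: 'rV[R]_n] (rV_coord i).
Proof.
move=> _ Y mY; rewrite setTI; apply: sub_sigma_algebra => /=.
rewrite -bigcup_seq/=; exists i => /=; first by rewrite mem_index_enum.
by exists Y => //; rewrite setTI.
Qed.

Lemma measurable_fun_rVP {R : realType} d (T : measurableType d) (n : nat)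
    (f : T -> 'rV[R]_n) :
  (forall i, measurable_fun setT (rV_coord i \o f)) -> measurable_fun setT f.
Proof.
move=> mf.
have prefS : g_sigma_preimage (fun i => rV_coord i \o f) `<=` measurable.
  apply: smallest_sub; first exact: sigma_algebra_measurable.
  case: n => [|n] in f mf *; first by rewrite big_ord0.
  rewrite -bigcup_mkord_ord; apply: bigcup_sub => i Ii.
  by move=> A [B mB <-]; exact: mf.
by move: prefS; rewrite g_sigma_preimage_comp => prefS _ A mA; apply: prefS; exists A.
Qed.

(* Lebesgue measure on R^n: leb 0 is the unit mass at the point, and leb n.+1 is
   the image of the product measure on R * R^n under (t, y) |-> (t, y_1, ..). *)

Section lebesgue_rV.
Context {R : realType}.

Definition rV_cons n (p : measurableTypeR R * 'rV[R]_n) : 'rV[R]_n.+1 :=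
  row_mx (p.1)%:M p.2.

Definition rV_uncons n (x : 'rV[R]_n.+1) : measurableTypeR R * 'rV[R]_n :=
  (x ord0 ord0, @rsubmx R 1 1 n x).

Lemma rV_consK n : cancel (@rV_cons n) (@rV_uncons n).
Proof.
move=> [t y]; rewrite /rV_uncons /rV_cons/= row_mxKr; congr pair.
have -> : (ord0 : 'I_n.+1) = lshift n (ord0 : 'I_1) by exact/val_inj.
by rewrite (@row_mxEl _ 1 1 n) mxE eqxx mulr1n.
Qed.

Lemma measurable_rV_cons n : measurable_fun setT (@rV_cons n).
Proof.
apply: measurable_fun_rVP => i.
rewrite -(@splitK 1 n i); case: (@fintype.split 1 n i) => j /=.
- rewrite (_ : _ \o _ = fst); first exact: measurable_fst.
  apply/funext => p /=; rewrite /rV_coord /rV_cons (@row_mxEl _ 1 1 n) mxE.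
  by rewrite (ord1 j) eqxx mulr1n.
- rewrite (_ : _ \o _ = rV_coord j \o snd).
    apply: measurableT_comp; last exact: measurable_snd.
    exact: measurable_rV_coord.
  by apply/funext => p /=; rewrite /rV_coord /rV_cons (@row_mxEr _ 1 1 n).
Qed.

Lemma measurable_rV_uncons n : measurable_fun setT (@rV_uncons n).
Proof.
apply/measurable_fun_pairP; split; first exact: measurable_rV_coord.
apply: measurable_fun_rVP => i.
rewrite (_ : _ \o _ = rV_coord (rshift 1 i : 'I_n.+1)).
  exact: measurable_rV_coord.
by apply/funext => x /=; rewrite /rV_coord mxE.
Qed.

Section succ.
Context n (mu : {sigma_finite_measure set 'rV[R]_n -> \bar R}).

Definition leb_succ : set 'rV[R]_n.+1 -> \bar R :=
  pushforward (lebesgue_measure \x mu)%E (@rV_cons n).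

Let leb_succ0 : leb_succ set0 = 0%E.
Proof. by rewrite /leb_succ /pushforward preimage_set0 measure0. Qed.

Let leb_succ_ge0 A : (0 <= leb_succ A)%E.
Proof. by rewrite /leb_succ /pushforward; exact: measure_ge0. Qed.

Let leb_succ_sigma_additive : semi_sigma_additive leb_succ.
Proof.
have m := @measurable_rV_cons n.
move=> F mF tF mUF; rewrite /leb_succ /pushforward preimage_bigcup.
apply: measure_semi_sigma_additive.
- by move=> k; rewrite -[X in measurable X]setTI; exact: m.
- apply/trivIsetP => /= i j _ _ ij; rewrite -preimage_setI.
  by move/trivIsetP : tF => /(_ _ _ _ _ ij) ->//; rewrite preimage_set0.
- by rewrite -preimage_bigcup -[X in measurable X]setTI; exact: m.
Qed.

HB.instance Definition _ := isMeasure.Build _ _ _ leb_succ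
  leb_succ0 leb_succ_ge0 leb_succ_sigma_additive.

Let leb_succ_sigma_finite : sigma_finite setT leb_succ.
Proof.
have /sigma_finiteP[F [TF ndF Foo]] := sigma_finiteT (@lebesgue_measure R).
have /sigma_finiteP[G [TG ndG Goo]] := sigma_finiteT mu.
exists (fun k => @rV_uncons n @^-1` (F k `*` G k)).
  rewrite -preimage_bigcup (_ : \bigcup_k _ = setT) ?preimage_setT//.
  rewrite -setXTT TF TG predeqE => -[x y]; split.
    by move=> [k _ [/= ? ?]]; split; exists k.
  move=> [/= [k _ Fkx] [l _ Gly]]; exists (maxn k l) => //; split.
  - by move: x Fkx; exact/subsetPset/ndF/leq_maxl.
  - by move: y Gly; exact/subsetPset/ndG/leq_maxr.
move=> k; have [mFk Fk] := Foo k; have [mGk Gk] := Goo k; split.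
  rewrite -[X in measurable X]setTI; apply: measurable_rV_uncons => //.
  exact: measurableX.
rewrite /leb_succ /pushforward -comp_preimage.
rewrite (_ : _ \o _ = id); last by apply/funext => p /=; exact: rV_consK.
by rewrite preimage_id product_measure1E// lte_mul_pinfty// ge0_fin_numE.
Qed.

HB.instance Definition _ := Measure_isSigmaFinite.Build _ _ _ leb_succ
  leb_succ_sigma_finite.

End succ.

Fixpoint leb n : {sigma_finite_measure set 'rV[R]_n -> \bar R} :=
  match n with
  | 0 => \d_(0 : 'rV[R]_0)
  | m.+1 => leb_succ (leb m)
  end.

Lemma leb_box n (A : 'I_n -> set R) : (forall i, measurable (A i)) ->
  leb n [set x | forall i, A i (x ord0 i)] =
  (\prod_(i < n) lebesgue_measure (A i))%E.
Proof.
have mbox m (B : 'I_m -> set R) : (forall i, measurable (B i)) ->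
    measurable [set x : 'rV[R]_m | forall i, B i (x ord0 i)].
  move=> mB; rewrite (_ : mkset _ = \bigcap_(i in [set: 'I_m]) (rV_coord i @^-1` B i)).
    apply: fin_bigcap_measurable => // i _.
    by rewrite -[X in measurable X]setTI; exact: measurable_rV_coord.
  by apply/seteqP; split => x /= H i *; exact: H.
elim: n A => [|n IHn] A mA.
  by rewrite big_ord0 /= diracE mem_set// => -[].
rewrite big_ord_recl -IHn; last by move=> i; exact: mA.
rewrite -product_measure1E; last 2 first.
  exact: mA.
  by apply: (mbox _ (fun i => A (lift ord0 i))) => i; exact: mA.
rewrite /= /leb_succ /pushforward; congr (_ _).
apply/seteqP; split => -[t y] /=; rewrite /rV_cons /=.
- move=> H; split.
    have := H ord0.
    have -> : (ord0 : 'I_n.+1) = lshift n (ord0 : 'I_1) by exact/val_inj.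
    by rewrite (@row_mxEl _ 1 1 n) mxE eqxx mulr1n.
  move=> i; have := H (lift ord0 i).
  have -> : lift ord0 i = (rshift 1 i : 'I_n.+1) by exact/val_inj.
  by rewrite (@row_mxEr _ 1 1 n).
- move=> [Ht Hy] i; rewrite -(@splitK 1 n i); case: (@fintype.split 1 n i) => j /=.
    rewrite (@row_mxEl _ 1 1 n) mxE (ord1 j) eqxx mulr1n.
    by have -> : (@lshift 1 n ord0 : 'I_n.+1) = ord0 by exact/val_inj.
  rewrite (@row_mxEr _ 1 1 n).
  by have -> : (@rshift 1 n j : 'I_n.+1) = lift ord0 j by exact/val_inj.
Qed.

End lebesgue_rV.

Section smooth.
Context {R : realType} {n : nat}.
Implicit Types (U Omega : set 'rV[R]_n) (f : 'rV[R]_n -> R).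

Definition partial (i : 'I_n) f : 'rV[R]_n -> R :=
  fun x => 'D_(delta_mx ord0 i) f x.

Definition iter_partial (s : seq 'I_n) f : 'rV[R]_n -> R := foldr partial f s.

Definition smooth_on U f := forall (s : seq 'I_n) x, U x ->
  {for x, continuous (iter_partial s f)} /\
  forall i, derivable (iter_partial s f) x (delta_mx ord0 i).

(* C^infty(closure Omega): restrictions of smooth functions on R^n. *)
Definition smooth_on_closure Omega f :=
  exists2 F, smooth_on setT F & {in closure Omega, f =1 F}.

(* For open Omega: near each boundary point, Omega is a strict sublevel set of
   a smooth function with nonvanishing gradient. *)
Definition smooth_boundary Omega := forall p, (closure Omega `\` Omega) p ->
  exists (U : set 'rV[R]_n) (rho : 'rV[R]_n -> R),
    [/\ open U, U p, smooth_on U rho, exists i, partial i rho p != 0 &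
        Omega `&` U = [set x | U x /\ rho x < 0]].

End smooth.

(* Elements of L^2(Omega) are represented by complex-valued functions on R^n, of
   which only the values on Omega matter; they are Borel measurable on Omega
   (every class has such representatives) and are identified when equal almost
   everywhere in Omega. *)

Section function_spaces.
Context {R : realType} {n : nat} (Omega : set 'rV[R]_n).
Implicit Types (u v : 'rV[R]_n -> R[i]) (Du Dv : 'I_n -> 'rV[R]_n -> R[i]).

Definition sqmod (z : R[i]) : R := complex.Re z ^+ 2 + complex.Im z ^+ 2.

Definition sqnorm u : \bar R := (\int[leb n]_(x in Omega) (sqmod (u x))%:E)%E.

Definition L2 u :=
  [/\ measurable_fun Omega (fun x => complex.Re (u x)),
      measurable_fun Omega (fun x => complex.Im (u x)) & (sqnorm u < +oo)%E].

Definition cintegral u : R[i] :=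
  (\int[leb n]_(x in Omega) complex.Re (u x)) +i*
  (\int[leb n]_(x in Omega) complex.Im (u x)).

Definition inner u v : R[i] := cintegral (fun x => u x * (v x)^*).

Definition cpartial (i : 'I_n) u : 'rV[R]_n -> R[i] := fun x =>
  partial i (fun y => complex.Re (u y)) x +i*
  partial i (fun y => complex.Im (u y)) x.

(* C_c^infty(Omega) *)
Definition test_function u :=
  [/\ smooth_on setT (fun x => complex.Re (u x)),
      smooth_on setT (fun x => complex.Im (u x)),
      compact (closure [set x | u x != 0]) &
      closure [set x | u x != 0] `<=` Omega].

Definition weak_partial (i : 'I_n) u v := forall phi, test_function phi ->
  cintegral (fun x => u x * cpartial i phi x) =
  - cintegral (fun x => v x * phi x).

(* u is in H^1(Omega), with weak gradient Du. *)
Definition H1 u Du := L2 u /\ forall i, L2 (Du i) /\ weak_partial i u (Du i).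

(* u is in H^1_0(Omega), the closure of C_c^infty(Omega) in H^1(Omega). *)
Definition H10 u Du := H1 u Du /\
  forall eps : R, 0 < eps -> exists2 phi, test_function phi &
    (sqnorm (fun x => (u x - phi x)%R) +
     \sum_(i < n) sqnorm (fun x => (Du i x - cpartial i phi x)%R) < eps%:E)%E.

End function_spaces.

(* Unbounded operators A on L^2(Omega) are given by their graphs: A u w means
   that u is in the domain of A and that A maps u to w. *)

Section operators.
Context {R : realType} {n : nat} (Omega : set 'rV[R]_n).
Local Notation fn := ('rV[R]_n -> R[i]).
Implicit Types (A : fn -> fn -> Prop) (u v w f : fn).

Definition dirichlet_form (g : 'rV[R]_n -> 'M[R]_n) (Du Dv : 'I_n -> fn) : R[i] :=
  cintegral Omega (fun x =>
    \sum_(j < n) \sum_(k < n) (g x j k)%:C * Du k x * (Dv j x)^*).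

Definition dirichlet_operator (g : 'rV[R]_n -> 'M[R]_n) u w :=
  L2 Omega w /\ exists2 Du, H10 Omega u Du &
    forall v Dv, H10 Omega v Dv -> dirichlet_form g Du Dv = inner Omega w v.

Definition op_eigenspace A (lam : R) u := A u (fun x => lam%:C * u x).

Definition op_eigenvalue A (lam : R) := exists2 u, op_eigenspace A lam u &
  ~ u = (fun=> 0) %[ae leb n in Omega].

Definition is_orthogonal_projection (V : set fn) f p :=
  V p /\ forall v, V v -> inner Omega (fun x => f x - p x) v = 0.

(* The spectral resolution of A, as a projection-valued measure [spec_proj] on
   the Borel sets of R; [spec_measure u] is the measure
   B |-> <spec_proj B u, u> = ||spec_proj B u||^2, and A is the integral of the
   identity: u is in the domain iff lam^2 is integrable, in which case
   <A u, u> is the integral of lam. *)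
Record spectral_resolution A := SpectralResolution {
  spec_proj : set R -> fn -> fn ;
  spec_measure : fn -> {measure set R -> \bar R} ;
  spec_proj_L2 : forall B u, measurable B -> L2 Omega u ->
    L2 Omega (spec_proj B u) ;
  spec_proj_sym : forall B u v, measurable B -> L2 Omega u -> L2 Omega v ->
    inner Omega (spec_proj B u) v = inner Omega u (spec_proj B v) ;
  spec_projI : forall B C u, measurable B -> measurable C -> L2 Omega u ->
    spec_proj (B `&` C) u = spec_proj B (spec_proj C u) %[ae leb n in Omega] ;
  spec_projT : forall u, L2 Omega u ->
    spec_proj setT u = u %[ae leb n in Omega] ;
  spec_measureE : forall B u, measurable B -> L2 Omega u ->
    spec_measure u B = sqnorm Omega (spec_proj B u) ;
  spec_domain : forall u, L2 Omega u ->
    (exists w, A u w) <-> (\int[spec_measure u]_lam (lam ^+ 2)%:E < +oo)%E ;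
  spec_formE : forall u w, A u w ->
    inner Omega w u = (\int[spec_measure u]_lam lam)%:C }.

(* f is in the domain of F(A), where F(A) is the integral of F against E. *)
Definition calculus_domain A (E : spectral_resolution A) (F : R -> R) f :=
  L2 Omega f /\ (\int[spec_measure E f]_lam (F lam ^+ 2)%:E < +oo)%E.

(* S_r(A) f(x), where e lam is the chosen representative of the projection of f
   onto the op_eigenspace of lam. *)
Definition partial_sum A (e : R -> fn) (r : R) : fn := fun x =>
  \sum_(lam \in [set lam | op_eigenvalue A lam /\ 0 <= lam <= r]) e lam x.

End operators.

(* Main.v *)
(** The partial sums are those of an orthogonal series, so this is the
    Rademacher-Menshov theorem, once two facts about the spectrum are known.

    Counting: P has at most O(m^n) eigenvalues below m, and more generally
    orthogonal families of energy at most m have at most O(m^n) elements.  An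
    H^1_0 function of energy m moves in L^2 by O(h m^(1/2)) under translations
    of size h, so for h of order 1/m averaging over cubes of side h almost fixes
    it, while Bessel's inequality applied to the averaging kernel bounds by
    O(h^(-n)) the size of an orthonormal family almost fixed by averaging.

    Discreteness: by the counting bound, the spectral measure of f has only
    finitely many support points in a bounded interval, and an atom of it gives
    an eigenvector.  Hence |f - S_r f|^2 <= mu_f(]r, oo[).

    The partial sums are then controlled by maximal functions over the ranges
    ]2^(2^j), 2^(2^(j+1))] of the spectral parameter.  By the dyadic
    Rademacher-Menshov inequality the j-th one has squared norm
    O(4^j mu_f(]2^(2^j), oo[)), which is summable because log(2 + P) f is in
    L^2. *)

Require Import Defs.
From HB Require Import structures.
From mathcomp Require Import all_boot all_order all_algebra.
From mathcomp Require Import complex.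
From mathcomp Require Import all_classical all_reals all_analysis.
From mathcomp Require Import measurable_realfun.
From mathcomp Require Import ring lra.

Set Implicit Arguments.
Unset Strict Implicit.
Unset Printing Implicit Defensive.

Import Order.TTheory GRing.Theory Num.Theory.
Import numFieldNormedType.Exports.

Local Open Scope classical_set_scope.
Local Open Scope ring_scope.
Local Open Scope complex_scope.

(** * Lebesgue measure on R^n *)

Section rV_Borel.
Context {R : realType} (n : nat).
Implicit Types (x y : 'rV[R]_n) (U : set 'rV[R]_n).

(** The operator is given only by its form and by an abstract projection-valued measure, with no
    eigenbasis at hand. Counting is therefore proved for arbitrary orthogonal families: it is first
    applied to spectral pieces [P (B x) u] with disjoint [B x], before any eigenvector is known.
    Moreover [spectral_resolution] describes the form of [A] on the diagonal only, so that [P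
    [set lam] u] is an eigenvector has itself to be recovered, by polarization and the symmetry of
    [A].

    The double exponential comes from the Rademacher-Menshov inequality, where a maximal partial sum
    of N orthogonal terms costs log^2 N. With polynomial counting log N is O(log lam), so cutting
    where log lam doubles keeps this cost comparable to log^2 lam on each range, which is exactly
    the weight that the domain of log(2 + P) controls. Any polynomial exponent serves equally well,
    which is why the counting argument can afford to be crude. *)

Lemma measurable_cylinder (i : 'I_n) (A : set R) :
  measurable A -> measurable [set x : 'rV[R]_n | A (x ord0 i)].
Proof.
by move=> mA; rewrite -[X in measurable X]setTI; exact: measurable_rV_coord.
Qed.

Lemma measurable_box (A : 'I_n -> set R) : (forall i, measurable (A i)) ->
  measurable [set x : 'rV[R]_n | forall i, A i (x ord0 i)].
Proof.
move=> mA; rewrite (_ : mkset _ =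
    \bigcap_(i in [set: 'I_n]) [set x : 'rV[R]_n | A i (x ord0 i)]).
  by apply: fin_bigcap_measurable => // i _; exact: measurable_cylinder.
by apply/seteqP; split => x /= H i *; exact: H.
Qed.

(** The sigma-algebra is generated by the coordinates, so [U] is written as a countable union of
    cubes: those with rational centre and half-side [1/(k+1)] that lie in [U]. *)
Lemma open_measurable_rV U : open U -> measurable U.
Proof.
move=> oU.
pose B (p : 'rV[rat]_n * nat) : set 'rV[R]_n :=
  [set x | forall i, `|ratr (p.1 ord0 i) - x ord0 i| < p.2.+1%:R^-1].
pose F p := if `[< B p `<=` U >] then B p else set0.
have mB p : measurable (B p).
  apply: (@measurable_box (fun i => ball (ratr (p.1 ord0 i) : R) p.2.+1%:R^-1)).
  by move=> i; apply: open_measurable; exact: ball_open.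
have mF p : measurable (F p) by rewrite /F; case: ifP.
rewrite (_ : U = \bigcup_p F p).
  by apply: countable_bigcupT_measurable => //; exact: countableP.
apply/seteqP; split => [x Ux|x [p _]]; last first.
  by rewrite /F; case: asboolP => // BU /BU.
have /nbhs_ballP[e /= e0 xeU] : nbhs x U by exact: open_nbhs_nbhs.
(* All points of a cube containing [x] are within two half-sides of [x]. *)
have [k ke] : exists k : nat, k.+1%:R^-1 + k.+1%:R^-1 < e.
  have [k _ /(_ k (leqnn k))/= ke] :=
    near_infty_natSinv_lt (PosNum (divr_gt0 e0 (ltr0Sn R 1))).
  by exists k; rewrite (splitr e) ltrD.
have k0 : 0 < k.+1%:R^-1 :> R by rewrite invr_gt0.
pose q := \row_i projT1 (cid (@rat_in_itvoo R (x ord0 i) _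
  (ltr_pwDr k0 (lexx (x ord0 i))))).
have Bx : B (q, k) x.
  move=> i; rewrite /= mxE; case: cid => r /=; rewrite in_itv/= => /andP[r1 r2].
  by rewrite gtr0_norm ?subr_gt0// ltrBlDl.
exists (q, k) => //; rewrite /F; case: asboolP => // -[] z Bz; apply: xeU.
split=> // i j; rewrite (ord1 i); apply: le_lt_trans ke.
rewrite -(subrKA (ratr (q ord0 j))).
rewrite (le_trans (ler_normD _ _))// lerD//; last exact: ltW (Bz j).
by rewrite distrC; exact: ltW (Bx j).
Qed.

Lemma continuous_measurable_rV (U : set 'rV[R]_n) (f : 'rV[R]_n -> R) : open U ->
  (forall x, U x -> {for x, continuous f}) -> measurable_fun U f.
Proof.
move=> oU cf; apply: (measurability _ (RGenOpens.measurableE R)).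
move=> /= _ [_ [a [b ->] <-]]; apply: open_measurable_rV.
rewrite openE => x [Ux fx]; apply: filterI; first exact: open_nbhs_nbhs.
by apply: cf => //; apply: open_nbhs_nbhs; split => //; exact: interval_open.
Qed.

Lemma measurable_add_rV :
  measurable_fun setT (fun p : 'rV[R]_n * 'rV[R]_n => p.1 + p.2).
Proof.
apply: measurable_fun_rVP => i.
rewrite (_ : _ \o _ = (fun p => rV_coord i p.1 + rV_coord i p.2)).
  apply: measurable_funD; apply: measurableT_comp => //;
    exact: measurable_rV_coord.
by apply/funext => p; rewrite /= /rV_coord mxE.
Qed.

Lemma measurable_translate (t : 'rV[R]_n) :
  measurable_fun setT (fun x : 'rV[R]_n => x + t).
Proof.
apply: measurable_fun_rVP => i.
rewrite (_ : _ \o _ = (fun x => rV_coord i x + t ord0 i)).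
  by apply: measurable_funD => //; exact: measurable_rV_coord.
by apply/funext => p; rewrite /= /rV_coord mxE.
Qed.

End rV_Borel.

(** * Translation invariance of Lebesgue measure *)

Section translation.
Context {R : realType}.

Lemma lebesgue_measure_translate (t : R) (A : set R) : measurable A ->
  lebesgue_measure [set x | A (x + t)] = lebesgue_measure A.
Proof.
move=> mA; have mt : measurable_fun setT
    ((fun x => x + t) : measurableTypeR R -> measurableTypeR R).
  exact: measurable_funD.
pose f : {mfun measurableTypeR R >-> measurableTypeR R} :=
  HB.pack (fun x : R => x + t) (isMeasurableFun.Build _ _ _ _ _ mt).
rewrite (_ : lebesgue_measure [set x | A (x + t)] =
  pushforward lebesgue_measure f A)//.
apply/esym/lebesgue_measure_unique => //= _ [[a b]] _ <-.
rewrite /pushforward (_ : _ @^-1` _ = `]a - t, b - t]%classic).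
  by rewrite !lebesgue_measure_itv/= !lte_fin ltrD2r -!EFinB opprB addrA subrK.
apply/seteqP; split => x /=; rewrite !in_itv/= => /andP[? ?]; apply/andP; split;
  lra.
Qed.

Lemma leb_translate n (t : 'rV[R]_n) (A : set 'rV[R]_n) : measurable A ->
  leb n [set x | A (x + t)] = leb n A.
Proof.
elim: n t A => [|n IHn] t A mA.
  by congr (leb 0 _); apply/funext => x /=; rewrite (thinmx0 t) addr0.
rewrite /= /leb_succ /pushforward.
set s := t ord0 ord0; set u : 'rV[R]_n := @rsubmx R 1 1 n t.
pose f (p : measurableTypeR R * 'rV[R]_n) : measurableTypeR R * 'rV[R]_n :=
  (p.1 + s, p.2 + u).
have mf : measurable_fun setT f.
  apply/measurable_fun_pairP; split.
    by apply: measurable_funD => //; exact: measurable_fst.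
  exact: measurableT_comp (measurable_translate u) measurable_snd.
pose F : {mfun (measurableTypeR R * 'rV[R]_n)%type >-> (measurableTypeR R * 'rV[R]_n)%type} :=
  HB.pack f (isMeasurableFun.Build _ _ _ _ _ mf).
have tE : t = row_mx s%:M u.
  rewrite -[LHS](@hsubmxK _ 1 1 n) (_ : @lsubmx R 1 1 n t = s%:M)//.
  apply/matrixP => i j; rewrite !ord1 !mxE eqxx mulr1n; congr (t _ _).
  exact/val_inj.
(* Through [rV_cons] the translation becomes the product map [f], so uniqueness of the product
   measure reduces the claim to rectangles. *)
rewrite (_ : _ @^-1` _ = f @^-1` (@rV_cons _ n @^-1` A)); last first.
  apply/funext => -[a b]; rewrite /preimage/=; congr A.
  rewrite /rV_cons /f tE /= raddfD; exact: (@add_row_mx _ 1 1 n).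
rewrite -[LHS]/(pushforward (lebesgue_measure \x leb n)%E F (@rV_cons R n @^-1` A)).
apply/esym/product_measure_unique => //=; last first.
  by rewrite -[X in measurable X]setTI; exact: measurable_rV_cons.
move=> B C mB mC; rewrite /pushforward.
rewrite (_ : _ @^-1` _ = [set x | B (x + s)] `*` [set x | C (x + u)])//.
rewrite product_measure1E ?IHn//.
- by congr (_ * _)%E; exact: lebesgue_measure_translate.
- rewrite -[X in measurable X]setTI.
  by apply: (@measurable_funD _ _ _ setT id (cst s)).
- by rewrite -[X in measurable X]setTI; exact: measurable_translate.
Qed.

Lemma ge0_integral_translate n (t : 'rV[R]_n) (f : 'rV[R]_n -> \bar R) :
  measurable_fun setT f -> (forall x, 0 <= f x)%E ->
  (\int[leb n]_x f (x + t)%R = \int[leb n]_x f x)%E.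
Proof.
move=> mf f0.
pose T : {mfun 'rV[R]_n >-> 'rV[R]_n} := HB.pack (fun x : 'rV[R]_n => x + t)
  (isMeasurableFun.Build _ _ _ _ _ (measurable_translate t)).
have := @ge0_integral_pushforward _ _ _ _ _ _ (measurable_translate t)
  (leb n) setT f measurableT mf (fun x _ => f0 x).
rewrite preimage_setT => <-.
have mE : forall A, measurable A -> A `<=` setT ->
    pushforward (leb n) T A = leb n A by move=> A mA _; exact: leb_translate.
exact: (eq_measure_integral (leb n) mE).
Qed.

End translation.

Lemma leb_bounded_lty {R : realType} n (U : set 'rV[R]_n) : bounded_set U ->
  measurable U -> (leb n U < +oo)%E.
Proof.
(* [bounded_set] provides bounds only for numbers strictly above [M]. *)
move=> [M [_ /(_ (M + 1) (ltr_pwDr ltr01 (lexx M)))]] /= UM mU.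
pose A (i : 'I_n) := `[- (M + 1), M + 1]%classic : set R.
have mA i : measurable (A i) by exact: measurable_itv.
apply: (@le_lt_trans _ _ (leb n [set x | forall i, A i (x ord0 i)])).
  apply: le_measure; rewrite ?inE//; first exact: measurable_box.
  move=> x /UM xM i; rewrite /A /= in_itv/= -ler_norml; apply: le_trans xM.
  rewrite [leRHS]/Num.norm /= mx_normrE; apply/bigmax_geP; right => /=.
  by exists (ord0, i).
rewrite leb_box// (_ : \prod_(i < n) _ = (\prod_(i < n)
    fine (lebesgue_measure (A i)))%:E)%E ?ltry//.
elim/big_rec2: _ => [//|i a b _ ->]; rewrite EFinM fineK//.
by rewrite /A/= lebesgue_measure_itv/=; case: ifP.
Qed.

(** * L^2 as a real Hilbert space *)

Section real_L2.
Context {R : realType} {n : nat} (D : set 'rV[R]_n).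
Local Notation fn := ('rV[R]_n -> R[i]).
Local Notation mu := (leb n).
Implicit Types (u v w : fn) (a b c : R) (z : R[i]).

Definition rdot (z w : R[i]) : R :=
  complex.Re z * complex.Re w + complex.Im z * complex.Im w.

(* The real part of [inner]. All orthogonality arguments below only need the
   real Hilbert space structure of L^2. *)
Definition rip u v : R := (\int[mu]_(x in D) rdot (u x) (v x))%R.

Definition rscale c u : fn := fun x => c%:C * u x.

Lemma rdotC z1 z2 : rdot z1 z2 = rdot z2 z1.
Proof. by rewrite /rdot; ring. Qed.

Lemma rdotDl z1 z2 z3 : rdot (z1 + z2) z3 = rdot z1 z3 + rdot z2 z3.
Proof. by case: z1 z2 z3 => [a b] [c d] [e f]; rewrite /rdot/=; ring. Qed.

Lemma rdotNl z1 z2 : rdot (- z1) z2 = - rdot z1 z2.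
Proof. by case: z1 z2 => [a b] [c d]; rewrite /rdot/=; ring. Qed.

Lemma rdotZl c z1 z2 : rdot (c%:C * z1) z2 = c * rdot z1 z2.
Proof. by case: z1 z2 => [a b] [d e]; rewrite /rdot/=; ring. Qed.

Lemma sqmodE z : sqmod z = rdot z z.
Proof. by rewrite /sqmod /rdot !expr2. Qed.

Lemma sqmod_ge0 z : 0 <= sqmod z.
Proof. by rewrite /sqmod addr_ge0// sqr_ge0. Qed.

Lemma sqmod0 : sqmod (0 : R[i]) = 0.
Proof. by rewrite /sqmod/= expr0n/= addr0. Qed.

Lemma sqmodN z : sqmod (- z) = sqmod z.
Proof. by case: z => a b; rewrite /sqmod/= !sqrrN. Qed.

Lemma sqmodZ c z : sqmod (c%:C * z) = c ^+ 2 * sqmod z.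
Proof. by case: z => a b; rewrite /sqmod/=; ring. Qed.

Lemma sqmod_eq0 z : sqmod z = 0 -> z = 0.
Proof.
move=> /eqP; rewrite paddr_eq0 ?sqr_ge0// !sqrf_eq0 => /andP[/eqP a0 /eqP b0].
by apply/eqP; rewrite eq_complex a0 b0/= eqxx.
Qed.

Lemma sqmodD_le z1 z2 : sqmod (z1 + z2) <= 2 * sqmod z1 + 2 * sqmod z2.
Proof.
case: z1 z2 => [a b] [c d]; rewrite /sqmod/=.
have := sqr_ge0 (a - c); have := sqr_ge0 (b - d); nra.
Qed.

Lemma ReD z1 z2 : complex.Re (z1 + z2) = complex.Re z1 + complex.Re z2.
Proof. by case: z1 z2 => [? ?] []. Qed.

Lemma ImD z1 z2 : complex.Im (z1 + z2) = complex.Im z1 + complex.Im z2.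
Proof. by case: z1 z2 => [? ?] []. Qed.

(** [L2] without finiteness: norm inequalities in [\bar R] can then be stated before the norms are
    known to be finite. *)
Definition cmeasurable u := measurable_fun D (fun x => complex.Re (u x)) /\
  measurable_fun D (fun x => complex.Im (u x)).

Lemma L2_cmeasurable u : L2 D u -> cmeasurable u.
Proof. by case. Qed.

Lemma cmeasurableD u v : cmeasurable u -> cmeasurable v ->
  cmeasurable (fun x => u x + v x).
Proof.
move=> [ru iu] [rv iv]; split.
- rewrite (_ : (fun _ => _) = fun x => complex.Re (u x) + complex.Re (v x)).
    exact: measurable_funD.
  by apply/funext => x; rewrite ReD.
- rewrite (_ : (fun _ => _) = fun x => complex.Im (u x) + complex.Im (v x)).
    exact: measurable_funD.
  by apply/funext => x; rewrite ImD.
Qed.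

Lemma cmeasurableZ c u : cmeasurable u -> cmeasurable (rscale c u).
Proof.
move=> [ru iu]; split.
- rewrite (_ : (fun _ => _) = fun x => c * complex.Re (u x)).
    exact: measurable_funM.
  by apply/funext => x; rewrite /rscale; case: (u x) => a b /=; ring.
- rewrite (_ : (fun _ => _) = fun x => c * complex.Im (u x)).
    exact: measurable_funM.
  by apply/funext => x; rewrite /rscale; case: (u x) => a b /=; ring.
Qed.

Lemma cmeasurableB u v : cmeasurable u -> cmeasurable v ->
  cmeasurable (fun x => u x - v x).
Proof.
move=> mu_ mv; rewrite (_ : (fun _ => _) = fun x => u x + rscale (-1) v x).
  by apply: cmeasurableD => //; exact: cmeasurableZ.
by apply/funext => x; rewrite /rscale rmorphN1 mulN1r.
Qed.

Hypothesis mD : measurable D.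

Lemma measurable_rdot u v : cmeasurable u -> cmeasurable v ->
  measurable_fun D (fun x => rdot (u x) (v x)).
Proof. by move=> [? ?] [? ?]; apply: measurable_funD; exact: measurable_funM. Qed.

Lemma measurable_sqmod u : cmeasurable u ->
  measurable_fun D (fun x => (sqmod (u x))%:E).
Proof.
move=> [? ?]; apply/measurable_EFinP.
by apply: measurable_funD; exact: measurable_funX.
Qed.

Lemma L2_sqmod_measurable u : L2 D u ->
  measurable_fun D (fun x => (sqmod (u x))%:E).
Proof. by move=> /L2_cmeasurable; exact: measurable_sqmod. Qed.

Lemma sqnorm_ge0 u : (0 <= sqnorm D u)%E.
Proof. by apply: integral_ge0 => x _; rewrite lee_fin sqmod_ge0. Qed.

Lemma sqnormD_le u v : cmeasurable u -> cmeasurable v ->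
  (sqnorm D (fun x => u x + v x)%R <= 2%:E * sqnorm D u + 2%:E * sqnorm D v)%E.
Proof.
move=> mu_ mv; have mW w : cmeasurable w ->
    measurable_fun D (fun x => 2%:E * (sqmod (w x))%:E)%E.
  by move=> mw; apply: measurable_funeM; exact: measurable_sqmod.
have pW w x : D x -> (0 <= (sqmod (w x))%:E)%E by rewrite lee_fin sqmod_ge0.
have pW2 w x : D x -> (0 <= 2%:E * (sqmod (w x))%:E)%E.
  by move=> _; rewrite mule_ge0// lee_fin sqmod_ge0.
rewrite /sqnorm -!ge0_integralZl//; try exact: measurable_sqmod; try exact: pW.
rewrite -ge0_integralD//; try exact: mW; try exact: pW2.
apply: ge0_le_integral => //.
- by move=> *; rewrite lee_fin sqmod_ge0.
- exact: (measurable_sqmod (cmeasurableD mu_ mv)).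
- by apply: emeasurable_funD; exact: mW.
- by move=> x _; rewrite -!EFinM -EFinD lee_fin sqmodD_le.
Qed.

Lemma sqnormZ c u : cmeasurable u ->
  sqnorm D (rscale c u) = ((c ^+ 2)%:E * sqnorm D u)%E.
Proof.
move=> mu_; rewrite /sqnorm -ge0_integralZl//; first last.
- by rewrite lee_fin sqr_ge0.
- by move=> *; rewrite lee_fin sqmod_ge0.
- exact: measurable_sqmod.
by apply: eq_integral => x _; rewrite sqmodZ EFinM.
Qed.

Lemma sqnormB_le u v : cmeasurable u -> cmeasurable v ->
  (sqnorm D (fun x => u x - v x)%R <= 2%:E * sqnorm D u + 2%:E * sqnorm D v)%E.
Proof.
move=> mu_ mv; rewrite (_ : (fun _ => _) = fun x => u x + rscale (-1) v x).
  apply: le_trans (sqnormD_le mu_ (cmeasurableZ _ mv)) _.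
  by rewrite sqnormZ// sqrrN expr1n mul1e.
by apply/funext => x; rewrite /rscale rmorphN1 mulN1r.
Qed.

Lemma L2_0 : L2 D (fun=> 0).
Proof.
split; [exact: measurable_cst..|].
rewrite /sqnorm; under eq_integral do rewrite sqmod0.
by rewrite integral0 ltry.
Qed.

Lemma L2D u v : L2 D u -> L2 D v -> L2 D (fun x => u x + v x).
Proof.
move=> Lu Lv; have mu_ := L2_cmeasurable Lu; have mv := L2_cmeasurable Lv.
have [? ?] := cmeasurableD mu_ mv; split => //.
apply: le_lt_trans (sqnormD_le mu_ mv) _.
case: Lu Lv => [_ _ Lu] [_ _ Lv].
by rewrite lte_add_pinfty// lte_mul_pinfty// ge0_fin_numE// sqnorm_ge0.
Qed.

Lemma L2Z c u : L2 D u -> L2 D (rscale c u).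
Proof.
move=> Lu; have mu_ := L2_cmeasurable Lu.
have [? ?] := cmeasurableZ c mu_; split => //.
case: Lu => [_ _ Lu]; rewrite sqnormZ//.
by rewrite lte_mul_pinfty// ?lee_fin ?sqr_ge0// ge0_fin_numE// sqnorm_ge0.
Qed.

Lemma L2B u v : L2 D u -> L2 D v -> L2 D (fun x => u x - v x).
Proof.
move=> Lu Lv; rewrite (_ : (fun _ => _) = fun x => u x + rscale (-1) v x).
  by apply: L2D => //; exact: L2Z.
by apply/funext => x; rewrite /rscale rmorphN1 mulN1r.
Qed.

Lemma L2_sum (I : Type) (s : seq I) (P : pred I) (u : I -> fn) :
  (forall i, L2 D (u i)) -> L2 D (fun x => \sum_(i <- s | P i) u i x).
Proof.
move=> Lu; elim: s => [|i s IHs].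
  by under [X in L2 _ X]eq_fun do rewrite big_nil; exact: L2_0.
under [X in L2 _ X]eq_fun do rewrite big_cons.
by case: (P i) => //; exact: L2D.
Qed.

Lemma rdot_integrable u v : L2 D u -> L2 D v ->
  mu.-integrable D (fun x => (rdot (u x) (v x))%:E).
Proof.
move=> Lu Lv; have mu_ := L2_cmeasurable Lu; have mv := L2_cmeasurable Lv.
have muv : measurable_fun D (fun x => (rdot (u x) (v x))%:E).
  by apply/measurable_EFinP; exact: measurable_rdot.
have muv2 : measurable_fun D (fun x => (sqmod (u x))%:E + (sqmod (v x))%:E)%E.
  by apply: emeasurable_funD; exact: measurable_sqmod.
apply: (le_integrable _ muv _ (g := fun x => (sqmod (u x))%:E + (sqmod (v x))%:E)%E) => //.
  move=> x _; rewrite -EFinD !abse_EFin lee_fin [leRHS]ger0_norm; last first.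
    by rewrite addr_ge0// sqmod_ge0.
  case: (u x) (v x) => [a b] [c d]; rewrite /rdot /sqmod/= ler_norml.
  have := sqr_ge0 (a + c); have := sqr_ge0 (b + d).
  have := sqr_ge0 (a - c); have := sqr_ge0 (b - d).
  by have := (sqr_ge0 a, sqr_ge0 b, sqr_ge0 c, sqr_ge0 d) => -[[[]]] *;
     apply/andP; split; nra.
apply/integrableP; split => //.
rewrite (eq_integral (fun x => (sqmod (u x))%:E + (sqmod (v x))%:E)%E).
  rewrite ge0_integralD//; try exact: measurable_sqmod;
    try by move=> *; rewrite lee_fin sqmod_ge0.
  by case: Lu Lv => [_ _ ?] [_ _ ?]; exact: lte_add_pinfty.
by move=> x _; rewrite gee0_abs// -EFinD lee_fin addr_ge0// sqmod_ge0.
Qed.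

Lemma ripC u v : rip u v = rip v u.
Proof. by rewrite /rip; under eq_Rintegral do rewrite rdotC. Qed.

Lemma ripDl u v w : L2 D u -> L2 D v -> L2 D w ->
  rip (fun x => u x + v x) w = rip u w + rip v w.
Proof.
move=> Lu Lv Lw; rewrite /rip -RintegralD//; try exact: rdot_integrable.
by apply: eq_Rintegral => x _; rewrite rdotDl.
Qed.

Lemma ripZl c u v : L2 D u -> L2 D v -> rip (rscale c u) v = c * rip u v.
Proof.
move=> Lu Lv; rewrite /rip -RintegralZl//; last exact: rdot_integrable.
by apply: eq_Rintegral => x _; rewrite rdotZl.
Qed.

Lemma ripBl u v w : L2 D u -> L2 D v -> L2 D w ->
  rip (fun x => u x - v x) w = rip u w - rip v w.
Proof.
move=> Lu Lv Lw; rewrite /rip -RintegralB//; try exact: rdot_integrable.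
by apply: eq_Rintegral => x _; rewrite rdotDl rdotNl.
Qed.

Lemma ripDr u v w : L2 D u -> L2 D v -> L2 D w ->
  rip w (fun x => u x + v x) = rip w u + rip w v.
Proof. by move=> *; rewrite ripC ripDl// ripC [in X in _ + X]ripC. Qed.

Lemma ripBr u v w : L2 D u -> L2 D v -> L2 D w ->
  rip w (fun x => u x - v x) = rip w u - rip w v.
Proof. by move=> *; rewrite ripC ripBl// ripC [in X in _ - X]ripC. Qed.

Lemma ripZr c u v : L2 D u -> L2 D v -> rip u (rscale c v) = c * rip u v.
Proof. by move=> *; rewrite ripC ripZl// ripC. Qed.

Lemma rip0l v : rip (fun=> 0) v = 0.
Proof.
rewrite /rip; under eq_Rintegral do rewrite /rdot/= !mul0r addr0.
by rewrite /Rintegral integral0.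
Qed.

Lemma rip_suml (I : Type) (s : seq I) (P : pred I) (u : I -> fn) v :
  (forall i, L2 D (u i)) -> L2 D v ->
  rip (fun x => \sum_(i <- s | P i) u i x) v = \sum_(i <- s | P i) rip (u i) v.
Proof.
move=> Lu Lv; elim: s => [|i s IHs].
  under [X in rip X _]eq_fun do rewrite big_nil.
  by rewrite rip0l big_nil.
under [X in rip X _]eq_fun do rewrite big_cons.
rewrite big_cons; case: (P i) => //; rewrite ripDl ?IHs//; exact: L2_sum.
Qed.

Lemma sqnorm_rip u : L2 D u -> sqnorm D u = (rip u u)%:E.
Proof.
move=> Lu; rewrite /rip /Rintegral.
have -> : (\int[mu]_(x in D) (rdot (u x) (u x))%:E)%E = sqnorm D u.
  by apply: eq_integral => x _; rewrite sqmodE.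
by rewrite fineK// ge0_fin_numE ?sqnorm_ge0//; case: Lu.
Qed.

Lemma rip_ge0 u : 0 <= rip u u.
Proof.
by apply: Rintegral_ge0 => x _; rewrite -sqmodE sqmod_ge0.
Qed.

Lemma rip_CauchySchwarz u v : L2 D u -> L2 D v ->
  rip u v ^+ 2 <= rip u u * rip v v.
Proof.
move=> Lu Lv; have [v0|v0] := eqVneq (rip v v) 0.
  (* the quadratic polynomial [|u + t v|^2] is affine in [t] when [|v| = 0] *)
  have H t : 0 <= rip u u + 2 * t * rip u v.
    have := rip_ge0 (fun x => u x + rscale t v x).
    rewrite ripDl ?ripDr ?ripZl ?ripZr//; try by do ?[apply: L2D|apply: L2Z].
    by rewrite v0 (ripC v u); lra.
  have [->|uv0] := eqVneq (rip u v) 0; first by rewrite expr0n v0 mulr0.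
  have := H (- (rip u u + 1) / (2 * rip u v)).
  rewrite (_ : 2 * _ * _ = - (rip u u + 1)); last by field.
  lra.
have v1 : 0 < rip v v by rewrite lt_def v0 rip_ge0.
have := rip_ge0 (fun x => u x - rscale (rip u v / rip v v) v x).
rewrite ripBl ?ripBr ?ripZl ?ripZr//; try by do ?[apply: L2B|apply: L2Z].
rewrite (ripC v u).
rewrite (_ : _ - _ = (rip u u * rip v v - rip u v ^+ 2) / rip v v); last by field.
by rewrite pmulr_lge0 ?invr_gt0// subr_ge0.
Qed.

Lemma rip_eq0 u : L2 D u -> rip u u = 0 -> u = (fun=> 0) %[ae mu in D].
Proof.
move=> Lu u0; have := sqnorm_rip Lu; rewrite u0.
have mu_ := measurable_sqmod (L2_cmeasurable Lu).
rewrite /sqnorm (eq_integral (fun x => `|(sqmod (u x))%:E|)%E); last first.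
  by move=> x _; rewrite gee0_abs// lee_fin sqmod_ge0.
move/(ae_eq_integral_abs mu mD mu_); apply: filterS => x /= H Dx.
by apply: sqmod_eq0; have [] := H Dx.
Qed.

Lemma ae_eq_rip_eq0 u : L2 D u -> u = (fun=> 0) %[ae mu in D] -> rip u u = 0.
Proof.
move=> Lu u0; apply: EFin_inj; rewrite -sqnorm_rip// /sqnorm.
rewrite (ae_eq_integral (cst 0%E))//; first by rewrite integral_cst// mul0e.
- exact: L2_sqmod_measurable.
- by apply: filterS u0 => x /= H Dx; rewrite H// sqmod0.
Qed.

Lemma rip_eq0l u v : L2 D u -> L2 D v -> rip u u = 0 -> rip u v = 0.
Proof.
move=> Lu Lv u0; have := rip_CauchySchwarz Lu Lv; rewrite u0 mul0r.
by move=> uv; apply/eqP; rewrite -sqrf_eq0 eq_le uv sqr_ge0.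
Qed.

Lemma rip_congr u u' v : L2 D u -> L2 D u' -> L2 D v ->
  u = u' %[ae mu in D] -> rip u v = rip u' v.
Proof.
move=> Lu Lu' Lv uu'; apply/eqP; rewrite -subr_eq0 -ripBl//; apply/eqP.
apply: rip_eq0l => //; first exact: L2B.
apply: ae_eq_rip_eq0; first exact: L2B.
by apply: filterS uu' => x /= H Dx; rewrite H// subrr.
Qed.

Lemma Re_inner u v : complex.Re (inner D u v) = rip u v.
Proof.
rewrite /inner /cintegral /rip /=; apply: eq_Rintegral => x _.
by case: (u x) (v x) => [a b] [c d]; rewrite /rdot/=; ring.
Qed.

Lemma rip_norm_sum (I : eqType) (s : seq I) (u : I -> fn) :
  (forall i, L2 D (u i)) -> uniq s ->
  {in s &, forall i j, i != j -> rip (u i) (u j) = 0} ->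
  rip (fun x => \sum_(i <- s) u i x) (fun x => \sum_(i <- s) u i x) =
  \sum_(i <- s) rip (u i) (u i).
Proof.
move=> Lu us ou; rewrite rip_suml//; last exact: L2_sum.
rewrite big_seq [RHS]big_seq; apply: eq_bigr => i si.
rewrite ripC rip_suml// (bigD1_seq i)//= big1_seq ?addr0// => j /andP[ji sj].
exact: ou.
Qed.

Lemma rip_Bessel (I : eqType) (s : seq I) (u : I -> fn) v :
  (forall i, L2 D (u i)) -> L2 D v -> uniq s ->
  {in s &, forall i j, rip (u i) (u j) = (i == j)%:R} ->
  \sum_(i <- s) rip (u i) v ^+ 2 <= rip v v.
Proof.
move=> Lu Lv us ou.
pose p x := \sum_(i <- s) rscale (rip (u i) v) (u i) x.
have Lp : L2 D p by apply: L2_sum => i; exact: L2Z.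
have pv : rip p v = \sum_(i <- s) rip (u i) v ^+ 2.
  rewrite rip_suml//; last by move=> i; exact: L2Z.
  by apply: eq_bigr => i _; rewrite ripZl.
have pp : rip p p = \sum_(i <- s) rip (u i) v ^+ 2.
  rewrite rip_norm_sum//; last 2 first.
  - by move=> i; exact: L2Z.
  - by move=> i j si sj /negPf ij; rewrite ripZl ?ripZr ?ou ?ij ?mulr0//; exact: L2Z.
  rewrite big_seq [RHS]big_seq; apply: eq_bigr => i si.
  by rewrite ripZl ?ripZr ?ou ?eqxx ?mulr1//; exact: L2Z.
have := rip_ge0 (fun x => v x - p x).
rewrite ripBl ?ripBr//; try exact: L2B.
by rewrite (ripC v p) pv pp subrr subr0 subr_ge0.
Qed.

End real_L2.

(** * Smooth increments along coordinate lines *)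

(** Cauchy-Schwarz against the constant 1. With [m] the integral of [f] and [J] that of [f ^+ 2],
    the integral of [(s * f - m) ^+ 2] is [s * (s * J - m ^+ 2)], which avoids a division by [s]. *)
Lemma Rintegral_sqr_le d (T : measurableType d) (R : realType)
    (mu : {measure set T -> \bar R}) (D : set T) (f : T -> R) (s : R) :
  measurable D -> mu D = s%:E -> mu.-integrable D (EFin \o f) ->
  mu.-integrable D (EFin \o (fun x => f x ^+ 2)) ->
  (((\int[mu]_(x in D) f x) ^+ 2)%R%:E <=
    s%:E * \int[mu]_(x in D) (f x ^+ 2)%:E)%E.
Proof.
move=> mD Ds if1 if2; set m := (\int[mu]_(x in D) f x)%R.
have icst (c : R) : mu.-integrable D (EFin \o (fun=> c)).
  apply/integrableP; split; first exact: measurable_cst.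
  by rewrite integral_cst// Ds -EFinM ltry.
have cstE (c : R) : (\int[mu]_(x in D) c = c * s)%R.
  by rewrite Rintegral_cst// Ds.
have : 0 <= (\int[mu]_(x in D) (s * f x - m) ^+ 2)%R.
  by apply: Rintegral_ge0 => x _; exact: sqr_ge0.
have -> : (\int[mu]_(x in D) (s * f x - m) ^+ 2 = \int[mu]_(x in D)
    ((s ^+ 2 * f x ^+ 2 - 2 * s * m * f x) + m ^+ 2))%R.
  by apply: eq_Rintegral => x _; ring.
have iZ (c : R) (k : T -> R) : mu.-integrable D (EFin \o k) ->
    mu.-integrable D (EFin \o (fun x => c * k x)).
  move=> ik; rewrite (_ : _ \o _ = fun x => (c%:E * (EFin \o k) x)%E).
    exact: integrableZl.
  by apply/funext => x; rewrite /= EFinM.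
have i1 := iZ (s ^+ 2) _ if2; have i2 := iZ (2 * s * m) _ if1.
have i3 : mu.-integrable D
    (EFin \o (fun x => s ^+ 2 * f x ^+ 2 - 2 * s * m * f x)).
  rewrite (_ : _ \o _ = (EFin \o (fun x => (s ^+ 2 * f x ^+ 2)%R)) \-
    (EFin \o (fun x => (2 * s * m * f x)%R)))%E; first exact: integrableB.
  by apply/funext => x; rewrite /= EFinB.
rewrite RintegralD// RintegralB// !RintegralZl// cstE -/m.
set J := Rintegral _ _ _ => J0.
have -> : (\int[mu]_(x in D) (f x ^+ 2)%:E = J%:E)%E.
  by rewrite /J /Rintegral fineK//; exact: integrable_fin_num.
have s0 : 0 <= s by rewrite -lee_fin -Ds measure_ge0.
(* For [s = 0] the set [D] is null, and both sides vanish. *)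
have := s0; rewrite le_eqVlt => /predU1P[s0'|{}s0].
  suff -> : m = 0 by rewrite -s0' expr0n mul0e.
  rewrite /m /Rintegral; apply/eqP; rewrite fine_eq0 ?integrable_fin_num//.
  by rewrite null_set_integral// ?Ds -?s0'//; case/integrableP: if1.
rewrite -EFinM lee_fin.
have : 0 <= s * (s * J - m ^+ 2).
  by apply: le_trans J0 _; rewrite le_eqVlt; apply/orP; left; apply/eqP; ring.
by rewrite pmulr_rge0// subr_ge0.
Qed.

Section line.
Context {R : realType}.
Local Notation mu := (@lebesgue_measure R).

Lemma sqr_increment_le (F F' : R -> R) (s : R) : 0 <= s ->
  (forall x : R, is_derive x (1 : R) F (F' x)) -> continuous F' ->
  (((F s - F 0) ^+ 2)%:E <= s%:E * \int[mu]_(x in `[0%R, s]) (F' x ^+ 2)%:E)%E.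
Proof.
rewrite le_eqVlt => /predU1P[<- _ _|s0 dF cF'].
  by rewrite subrr expr0n/= mul0e.
have cF : continuous F.
  by move=> x; apply/differentiable_continuous/derivable1_diffP; have [] := dF x.
have ftc : (\int[mu]_(x in `[0%R, s]) (F' x)%:E = (F s - F 0)%:E)%E.
  rewrite (@continuous_FTC2 _ F' F 0 s)//.
  - exact: continuous_subspaceT.
  - split; first by move=> x _; have [] := dF x.
    + by apply: cvg_at_right_filter; exact: cF.
    + by apply: cvg_at_left_filter; exact: cF.
  - by move=> x _; rewrite derive1E; have [_ ->] := dF x.
have iF' : mu.-integrable `[0, s] (EFin \o F').
  apply: continuous_compact_integrable; first exact: segment_compact.
  exact: continuous_subspaceT.
have iF'2 : mu.-integrable `[0, s] (EFin \o (fun x => F' x ^+ 2)).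
  apply: continuous_compact_integrable; first exact: segment_compact.
  by apply: continuous_subspaceT => x; exact: (continuous_comp (cF' x) (@exprn_continuous _ 2 _)).
have mI : measurable (`[0, s]%classic : set (measurableTypeR R)).
  exact: measurable_itv.
have sE : mu `[0, s]%classic = s%:E by rewrite lebesgue_measure_itv/= lte_fin s0 sube0.
rewrite (_ : F s - F 0 = \int[mu]_(x in `[0, s]) F' x)%R; last first.
  by rewrite /Rintegral ftc.
by have := Rintegral_sqr_le mI sE iF' iF'2.
Qed.

End line.

Section directional.
Context {R : realType} {n : nat}.
Implicit Types (f : 'rV[R]_n -> R) (i : 'I_n).
Local Notation "''e_' i" := (@delta_mx R 1 n ord0 i) (at level 8, format "''e_' i").

Lemma smooth_continuous f : smooth_on setT f -> continuous f.
Proof. by move=> sf x; have [] := sf [::] x I. Qed.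

Lemma smooth_partial_continuous f i : smooth_on setT f -> continuous (partial i f).
Proof. by move=> sf x; have [] := sf [:: i] x I. Qed.

Lemma partial_line f i (x : 'rV[R]_n) (t : R) : smooth_on setT f ->
  is_derive t 1 (fun s => f (x + s *: 'e_i)) (partial i f (x + t *: 'e_i)).
Proof.
move=> sf; have [_ /(_ i) df] := sf [::] (x + t *: 'e_i) I.
have E : (fun h : R => h^-1 *: ((f \o shift (x + t *: 'e_i)) (h *: 'e_i) -
    f (x + t *: 'e_i))) =
  (fun h : R => h^-1 *: (((fun s => f (x + s *: 'e_i)) \o shift t) (h *: 1) -
    f (x + t *: 'e_i))).
  apply/funext => h /=; congr (_ *: (f _ - _)).
  by rewrite [h%:A]mulr1 scalerDl addrCA.
by split; rewrite /derivable/= /partial /derive/= -?E.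
Qed.

Lemma line_continuous (x : 'rV[R]_n) i : continuous (fun t : R => x + t *: 'e_i).
Proof.
move=> t; apply: cvgD; first exact: cvg_cst.
exact: scalel_continuous.
Qed.

Lemma measurable_line i : measurable_fun setT
  (fun p : 'rV[R]_n * measurableTypeR R => p.1 + (p.2 : R) *: 'e_i).
Proof.
apply: measurable_fun_rVP => j.
set c : R := ('e_i) ord0 j.
have M1 : measurable_fun setT (fun p : 'rV[R]_n * measurableTypeR R => rV_coord j p.1).
  exact: (measurableT_comp (measurable_rV_coord j) measurable_fst).
have Mc : measurable_fun [set: measurableTypeR R] (fun r : measurableTypeR R => (r : R) * c).
  exact: (measurable_funM (f := id) (g := cst c)).
have M2 : measurable_fun setT
    (fun p : 'rV[R]_n * measurableTypeR R => (p.2 : R) * c).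
  exact: measurableT_comp Mc measurable_snd.
have M3 : measurable_fun setT (fun p : 'rV[R]_n * measurableTypeR R =>
    rV_coord j p.1 + (p.2 : R) * c) by exact: measurable_funD M1 M2.
have E : rV_coord j \o (fun p : 'rV[R]_n * measurableTypeR R =>
    p.1 + (p.2 : R) *: 'e_i) = (fun p => rV_coord j p.1 + (p.2 : R) * c).
  apply/funext => p; rewrite /= /rV_coord /c mxE; congr (_ + _).
  by rewrite mxE.
by rewrite E.
Qed.

(** On each line in direction [i], the fundamental theorem of calculus and Cauchy-Schwarz bound the
    squared increment by [s] times the integral of [partial i f ^+ 2] over a segment of length [s];
    then integrate over all lines. *)
Lemma integral_increment_le f i (s : R) : 0 <= s -> smooth_on setT f ->
  (\int[leb n]_x ((f (x + s *: 'e_i)%R - f x) ^+ 2)%:E <=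
   (s ^+ 2)%:E * \int[leb n]_x (partial i f x ^+ 2)%:E)%E.
Proof.
move=> s0 sf; pose g x := partial i f x ^+ 2.
have mg : measurable_fun setT g.
  apply: measurable_funX; apply: continuous_measurable_rV; first exact: openT.
  by move=> x _; exact: smooth_partial_continuous.
have mf : measurable_fun setT f.
  apply: continuous_measurable_rV; first exact: openT.
  by move=> x _; exact: smooth_continuous.
pose G (p : 'rV[R]_n * measurableTypeR R) : \bar R :=
  (\1_(`[0, s]%classic : set R) p.2 * g (p.1 + (p.2 : R) *: 'e_i))%:E.
have mI : measurable (`[0, s]%classic : set (measurableTypeR R)).
  exact: measurable_itv.
have G0 p : (0 <= G p)%E by rewrite lee_fin mulr_ge0// sqr_ge0.
have mG : measurable_fun setT G.
  apply/measurable_EFinP; apply: measurable_funM.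
    exact: measurableT_comp (measurable_indic mI) measurable_snd.
  exact: measurableT_comp mg (measurable_line i).
apply: (@le_trans _ _ (\int[leb n]_x (s%:E * \int[lebesgue_measure]_t G (x, t)))%E).
  apply: ge0_le_integral => //.
  - by move=> x _; rewrite lee_fin sqr_ge0.
  - apply/measurable_EFinP; apply: measurable_funX; apply: measurable_funB => //.
    exact: measurableT_comp mf (measurable_translate _).
  - apply: measurable_funeM.
    exact: (measurable_fun_fubini_tonelli_F (m2 := lebesgue_measure) G).
  - move=> x _; pose F t := f (x + t *: 'e_i).
    have -> : f x = F 0 by rewrite /F scale0r addr0.
    apply: le_trans (sqr_increment_le s0 (fun t => partial_line i x t sf) _) _.
      move=> t; apply: continuous_comp; first exact: line_continuous.
      exact: smooth_partial_continuous.
    rewrite lee_wpmul2l ?lee_fin// integral_mkcond le_eqVlt; apply/orP; left.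
    apply/eqP; apply: eq_integral => t _; rewrite /G patchE indicE/=.
    by case: ifP => _; rewrite ?mul1r ?mul0r.
rewrite ge0_integralZl//; last 2 first.
- exact: (measurable_fun_fubini_tonelli_F (m2 := lebesgue_measure) G).
- by move=> x _; apply: integral_ge0.
rewrite (fubini_tonelli (m1 := leb n) (m2 := lebesgue_measure) G)//.
rewrite expr2 EFinM -muleA lee_wpmul2l ?lee_fin//.
set J := (\int[leb n]_x (g x)%:E)%E.
(* By translation invariance the inner integral is the same for all [t] in [[0, s]], so the second
   factor [s] is the length of this interval. *)
have GJ t : (\int[leb n]_x G (x, t) = (\1_(`[0, s]%classic : set R) t)%:E * J)%E.
  have mgt : measurable_fun setT (fun x : 'rV[R]_n => (g (x + t *: 'e_i))%:E).
    apply/measurable_EFinP; exact: measurableT_comp mg (measurable_translate _).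
  have gt0 (x : 'rV[R]_n) : setT x -> (0 <= (g (x + t *: 'e_i)%R)%:E)%E.
    by move=> _; rewrite lee_fin sqr_ge0.
  have <- : (\int[leb n]_x (g (x + t *: 'e_i)%R)%:E = J)%E.
    apply: (ge0_integral_translate (t *: 'e_i) (f := fun x => (g x)%:E)).
      exact/measurable_EFinP.
    by move=> x; rewrite lee_fin sqr_ge0.
  rewrite -(ge0_integralZl_EFin (leb n) measurableT gt0 mgt)//.
under eq_integral do rewrite GJ.
rewrite ge0_integralZr//; last by apply: integral_ge0 => x _; rewrite lee_fin sqr_ge0.
  rewrite integral_indic// setIT; apply: lee_wpmul2r.
    by apply: integral_ge0 => x _; rewrite lee_fin sqr_ge0.
  have : (lebesgue_measure (`[0%R, s]%classic : set R) <= s%:E)%E.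
    by rewrite lebesgue_measure_itv/= lte_fin sube0; case: ifP; rewrite // lee_fin.
  exact.
exact/measurable_EFinP/measurable_indic.
Qed.

End directional.

(** * Translates of functions in H^1_0 *)

Section translates.
Context {R : realType} {n : nat}.
Local Notation fn := ('rV[R]_n -> R[i]).
Implicit Types (u v phi : fn) (t : 'rV[R]_n) (Omega : set 'rV[R]_n).

Lemma cmeasurable_translate t u : cmeasurable setT u ->
  cmeasurable setT (fun x => u (x + t)).
Proof.
move=> [ru iu]; split.
- exact: measurableT_comp ru (measurable_translate t).
- exact: measurableT_comp iu (measurable_translate t).
Qed.

Lemma sqnorm_translate t u : cmeasurable setT u ->
  sqnorm setT (fun x => u (x + t)) = sqnorm setT u.
Proof.
move=> mu; apply: (@ge0_integral_translate _ _ t (fun x => (sqmod (u x))%:E)).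
  exact: measurable_sqmod.
by move=> x; rewrite lee_fin sqmod_ge0.
Qed.

Lemma sqnorm_ReIm u : cmeasurable setT u ->
  sqnorm setT u = (\int[leb n]_x (complex.Re (u x) ^+ 2)%:E +
                   \int[leb n]_x (complex.Im (u x) ^+ 2)%:E)%E.
Proof.
move=> [ru iu]; rewrite -ge0_integralD//.
- by move=> x _; rewrite lee_fin sqr_ge0.
- by apply/measurable_EFinP; exact: measurable_funX.
- by move=> x _; rewrite lee_fin sqr_ge0.
- by apply/measurable_EFinP; exact: measurable_funX.
Qed.

Definition csmooth u := smooth_on setT (fun x => complex.Re (u x)) /\
  smooth_on setT (fun x => complex.Im (u x)).

Lemma csmooth_measurable u : csmooth u -> cmeasurable setT u.
Proof.
by move=> [ru iu]; split; apply: continuous_measurable_rV => [|x _];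
  [exact: openT|exact: smooth_continuous|exact: openT|exact: smooth_continuous].
Qed.

Lemma cpartial_measurable i u : csmooth u -> cmeasurable setT (cpartial i u).
Proof.
move=> [ru iu]; split.
- apply: continuous_measurable_rV => [|x _]; first exact: openT.
  exact: smooth_partial_continuous.
- apply: continuous_measurable_rV => [|x _]; first exact: openT.
  exact: smooth_partial_continuous.
Qed.

Lemma sqnorm_increment_le u i (s : R) : 0 <= s -> csmooth u ->
  (sqnorm setT (fun x => (u (x + s *: delta_mx ord0 i) - u x)%R) <=
   (s ^+ 2)%:E * sqnorm setT (cpartial i u))%E.
Proof.
move=> s0 su; have mu := csmooth_measurable su.
have mt := cmeasurable_translate (s *: delta_mx ord0 i) mu.
rewrite sqnorm_ReIm; last exact: cmeasurableB.
rewrite sqnorm_ReIm; last exact: cpartial_measurable.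
rewrite ge0_muleDr; last 2 first.
- by apply: integral_ge0 => x _; rewrite lee_fin sqr_ge0.
- by apply: integral_ge0 => x _; rewrite lee_fin sqr_ge0.
case: su => ru iu; apply: leeD.
- under eq_integral do rewrite raddfB/=.
  exact: (@integral_increment_le _ _ (fun x => complex.Re (u x))).
- under eq_integral do rewrite raddfB/=.
  exact: (@integral_increment_le _ _ (fun x => complex.Im (u x))).
Qed.

(** The translation is made one coordinate at a time. Each further step doubles the constant,
    through [sqnormD_le], whence the power of 2. *)
Lemma sqnorm_steps_le u (h : R) t (r : seq 'I_n) : csmooth u ->
  (forall i, 0 <= t ord0 i <= h) ->
  (sqnorm setT (fun x =>
     (u (x + \sum_(i <- r) t ord0 i *: delta_mx ord0 i) - u x)%R) <=
   (2 ^+ size r * h ^+ 2)%:E * \sum_(i <- r) sqnorm setT (cpartial i u))%E.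
Proof.
move=> su th; have mu := csmooth_measurable su.
elim: r => [|i r IHr].
  rewrite !big_nil mule0 /sqnorm; under eq_integral do rewrite addr0 subrr sqmod0.
  by rewrite integral0.
rewrite !big_cons; set T := \sum_(j <- r) _.
pose v x := u (x + T) - u x.
pose w x := u (x + t ord0 i *: delta_mx ord0 i) - u x.
have mv : cmeasurable setT v.
  by apply: cmeasurableB => //; exact: cmeasurable_translate.
have mw : cmeasurable setT w.
  by apply: cmeasurableB => //; exact: cmeasurable_translate.
have [ti0 tih] := andP (th i).
have -> : (fun x => u (x + (t ord0 i *: delta_mx ord0 i + T)) - u x) =
    (fun x => w (x + T) + v x).
  by apply/funext => x; rewrite /w /v subrKA -addrA [T + _]addrC.
apply: le_trans (sqnormD_le _ _ _) _ => //; first exact: cmeasurable_translate.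
rewrite sqnorm_translate//.
have S0 : (0 <= \sum_(j <- r) sqnorm setT (cpartial j u))%E.
  by apply: sume_ge0 => j _; exact: sqnorm_ge0.
have P0 := sqnorm_ge0 setT (cpartial i u).
rewrite [leRHS]ge0_muleDr// [size _]/= exprS; apply: leeD.
  apply: (@le_trans _ _ (2%:E * ((h ^+ 2)%:E * sqnorm setT (cpartial i u)))%E).
    rewrite lee_wpmul2l ?lee_fin//; apply: le_trans (sqnorm_increment_le _ _ _) _ => //.
    by rewrite lee_wpmul2r// lee_fin ler_sqr ?nnegrE// (le_trans ti0).
  rewrite muleA -EFinM lee_wpmul2r// lee_fin -mulrA ler_pM2l//.
  by rewrite ler_peMl ?sqr_ge0// exprn_ege1// ler1n.
by rewrite -mulrA EFinM -muleA lee_wpmul2l// lee_fin.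
Qed.

Lemma sqnorm_box_translate_le u (h : R) t : csmooth u ->
  (forall i, 0 <= t ord0 i <= h) ->
  (sqnorm setT (fun x => (u (x + t) - u x)%R) <=
   (2 ^+ n * h ^+ 2)%:E * \sum_(i < n) sqnorm setT (cpartial i u))%E.
Proof.
move=> su th; have := sqnorm_steps_le (index_enum 'I_n) su th.
by rewrite -row_sum_delta /index_enum -enumT size_enum_ord.
Qed.

Lemma test_function_eq0 Omega phi x : test_function Omega phi -> ~ Omega x ->
  phi x = 0.
Proof.
move=> [_ _ _ sO] nO; apply/eqP; apply: contrapT => /negP phix.
by apply: nO; apply: sO; exact: subset_closure.
Qed.

(** At a boundary point the vanishing of [phi] at the point alone would say nothing about
    derivatives; since the closed support lies in [Omega], [phi] vanishes in a whole
    neighbourhood. *)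
Lemma test_function_cpartial_eq0 Omega phi i x : test_function Omega phi ->
  ~ Omega x -> cpartial i phi x = 0.
Proof.
move=> [_ _ _ sO] nO.
have phi0 : \near x, phi x = 0.
  have : open (~` closure [set x | phi x != 0]) by exact/closed_openC/closed_closure.
  rewrite openE => /(_ x (fun xS => nO (sO _ xS))); apply: filterS => y /= ny.
  by apply/eqP; apply: contrapT => /negP phiy; apply: ny; exact: subset_closure.
rewrite /cpartial /partial.
rewrite (near_eq_derive (g := cst 0)); last by apply: filterS phi0 => y /= ->.
rewrite (near_eq_derive (g := cst 0)); last by apply: filterS phi0 => y /= ->.
by rewrite derive_cst.
Qed.

Definition zero_ext Omega u : fn := fun x => if x \in Omega then u x else 0.

Lemma sqnorm_zero_ext Omega u : measurable Omega ->
  sqnorm setT (zero_ext Omega u) = sqnorm Omega u.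
Proof.
move=> mO; rewrite /sqnorm [RHS]integral_mkcond; apply: eq_integral => x _.
by rewrite /zero_ext ?patchE; case: ifP; rewrite ?sqmod0.
Qed.

Lemma cmeasurable_zero_ext Omega u : measurable Omega -> cmeasurable Omega u ->
  cmeasurable setT (zero_ext Omega u).
Proof.
move=> mO [ru iu]; split.
- rewrite (_ : (fun _ => _) = ((fun x => complex.Re (u x)) \_ Omega)).
    by apply/measurable_restrict => //; rewrite setTI.
  by apply/funext => x; rewrite /zero_ext ?patchE; case: ifP.
- rewrite (_ : (fun _ => _) = ((fun x => complex.Im (u x)) \_ Omega)).
    by apply/measurable_restrict => //; rewrite setTI.
  by apply/funext => x; rewrite /zero_ext ?patchE; case: ifP.
Qed.

Lemma L2_zero_ext Omega u : measurable Omega -> L2 Omega u -> L2 setT (zero_ext Omega u).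
Proof.
move=> mO Lu; have [? ?] := cmeasurable_zero_ext mO (L2_cmeasurable Lu).
by split => //; rewrite sqnorm_zero_ext//; case: Lu.
Qed.

(** The bound passes from test functions to the limit; extension by zero is compatible with this
    because test functions vanish off [Omega]. Compared with the constant [2 ^+ n] for smooth
    functions, one factor 2 comes from writing [u] as [(u - phi) + phi], the other from comparing
    the gradient of [phi] with [Du]. *)
Lemma H10_translate_le Omega u (Du : 'I_n -> fn) (h : R) t : measurable Omega ->
  H10 Omega u Du -> (forall i, 0 <= t ord0 i <= h) ->
  (sqnorm setT (fun x => ((zero_ext Omega u) (x + t) - (zero_ext Omega u) x)%R) <=
   (2 ^+ n.+2 * h ^+ 2)%:E * \sum_(i < n) sqnorm Omega (Du i))%E.
Proof.
move=> mO [[Lu LDu] uapp] th; set U := zero_ext Omega u.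
set S := (\sum_(i < n) sqnorm Omega (Du i))%E.
pose C : R := 2 ^+ n.+2 * h ^+ 2.
have C0 : 0 <= C by rewrite mulr_ge0 ?sqr_ge0.
apply/lee_addgt0Pr => e e0.
(* The error will be [8 * A + C * B], where [A] and [B] are the two parts of the approximation
   error. *)
have d0 : 0 < e / (8 + C) by rewrite divr_gt0// ltr_wpDr.
have [phi tphi] := uapp _ d0.
set A := sqnorm _ _; set B := (\sum_(i < n) _)%E => ABd.
have A0 : (0 <= A)%E by exact: sqnorm_ge0.
have B0 : (0 <= B)%E by apply: sume_ge0 => i _; exact: sqnorm_ge0.
have sphi : csmooth phi by case: tphi.
have mphi := csmooth_measurable sphi.
have mU : cmeasurable setT U by apply: cmeasurable_zero_ext => //; exact: L2_cmeasurable.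
pose w x := U x - phi x.
have mw : cmeasurable setT w by exact: cmeasurableB.
have wA : sqnorm setT w = A.
  rewrite -[RHS]sqnorm_zero_ext//; congr sqnorm; apply/funext => x.
  rewrite /w /U /zero_ext ?patchE; case: ifPn => // /negP; rewrite in_setE => nO.
  by rewrite (test_function_eq0 tphi nO) subrr.
have dphi i : (sqnorm setT (cpartial i phi) <=
    2%:E * sqnorm Omega (Du i) + 2%:E * sqnorm Omega (fun x => (Du i x - cpartial i phi x)%R))%E.
  have mDi : cmeasurable Omega (Du i) by have [/L2_cmeasurable] := LDu i.
  have mdphi : cmeasurable Omega (cpartial i phi).
    by have [? ?] := cpartial_measurable i sphi; split; exact: measurable_funTS.
  have -> : sqnorm setT (cpartial i phi) = sqnorm Omega (cpartial i phi).
    rewrite -[RHS]sqnorm_zero_ext//; congr sqnorm; apply/funext => x.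
    rewrite /zero_ext ?patchE; case: ifPn => // /negP; rewrite in_setE => nO.
    exact: test_function_cpartial_eq0 tphi nO.
  rewrite (_ : sqnorm Omega (cpartial i phi) =
      sqnorm Omega (fun x => Du i x - (Du i x - cpartial i phi x))%R); last first.
    by congr sqnorm; apply/funext => x; rewrite subKr.
  by apply: sqnormB_le => //; exact: cmeasurableB.
have -> : (fun x => U (x + t) - U x) =
    (fun x => (w (x + t) - w x) + (phi (x + t) - phi x)).
  by apply/funext => x; rewrite /w; ring.
have mwt := cmeasurable_translate t mw; have mpt := cmeasurable_translate t mphi.
apply: le_trans (sqnormD_le _ (cmeasurableB mwt mw) (cmeasurableB mpt mphi)) _ => //.
have Aw : (2%:E * sqnorm setT (fun x => (w (x + t) - w x)%R) <= 8%:E * A)%E.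
  rewrite (_ : 8 = 2 * 4); last by ring.
  rewrite EFinM -muleA lee_wpmul2l ?lee_fin//.
  apply: le_trans (sqnormB_le _ mwt mw) _ => //.
  rewrite sqnorm_translate// wA -ge0_muleDl ?lee_fin// -EFinD lee_wpmul2r//.
  by rewrite lee_fin; lra.
have Ap : (2%:E * sqnorm setT (fun x => (phi (x + t) - phi x)%R) <=
    C%:E * (S + B))%E.
  have -> : C = 2 * (2 ^+ n * h ^+ 2) * 2 by rewrite /C !exprS; ring.
  rewrite (EFinM _ 2) (EFinM 2) -!muleA lee_wpmul2l ?lee_fin//.
  apply: le_trans (sqnorm_box_translate_le sphi th) _.
  have c0 : 0 <= 2 ^+ n * h ^+ 2.
    by apply: mulr_ge0; [exact: exprn_ge0|exact: sqr_ge0].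
  apply: lee_wpmul2l; first by rewrite lee_fin.
  rewrite [leRHS]ge0_muleDr//; last first.
    by apply: sume_ge0 => i _; exact: sqnorm_ge0.
  rewrite /S /B !ge0_sume_distrr; try by move=> i _; exact: sqnorm_ge0.
  by rewrite -big_split; apply: lee_sum => i _; exact: dphi.
apply: le_trans (leeD Aw Ap) _.
rewrite [(C%:E * _)%E]ge0_muleDr//; last by apply: sume_ge0 => i _; exact: sqnorm_ge0.
rewrite addeCA leeD2l//.
have Ae : (A <= (e / (8 + C))%:E)%E by rewrite (le_trans _ (ltW ABd))// leeDl.
have Be : (B <= (e / (8 + C))%:E)%E by rewrite (le_trans _ (ltW ABd))// leeDr.
apply: (@le_trans _ _ (8%:E * (e / (8 + C))%:E + C%:E * (e / (8 + C))%:E)%E).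
  by apply: leeD; rewrite lee_wpmul2l ?lee_fin.
rewrite -!EFinM -EFinD lee_fin -mulrDl mulrCA divff ?mulr1//.
by rewrite gt_eqF// ltr_wpDr.
Qed.

End translates.

(** * Counting orthogonal families with bounded energy *)

Section counting.
Context {R : realType} {n : nat}.
Local Notation fn := ('rV[R]_n -> R[i]).
Implicit Types (u v : fn) (A Q V : set 'rV[R]_n) (z : R[i]).

Lemma rip_zero_ext A u v :
  rip setT u (zero_ext A v) = rip A u v.
Proof.
rewrite /rip [RHS]Rintegral_mkcond; apply: eq_Rintegral => x _.
rewrite patchE /zero_ext; case: ifP => // _.
by rewrite /rdot/= !mulr0 addr0.
Qed.

Lemma rip_zero_ext2 A u v : rip A u (zero_ext A v) = rip A u v.
Proof.
by apply: eq_Rintegral => x xA; rewrite /zero_ext xA.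
Qed.

Lemma L2_setT_sub A u : measurable A -> L2 setT u -> L2 A u.
Proof.
move=> mA Lu; have [ru iu uoo] := Lu; split.
- exact: measurable_funS ru.
- exact: measurable_funS iu.
- apply: le_lt_trans uoo; apply: ge0_subset_integral => //.
  + exact: L2_sqmod_measurable.
  + by move=> x _; rewrite lee_fin sqmod_ge0.
Qed.

Lemma L2_cst A z (q : R) : measurable A -> leb n A = q%:E -> L2 A (cst z).
Proof.
move=> mA Aq; split; [exact: measurable_cst..|].
rewrite /sqnorm (_ : (fun _ => _) = cst (sqmod z)%:E)//.
by rewrite integral_cst// [X in (_ * X)%E]Aq -EFinM ltry.
Qed.

Lemma rip_cst A z w (q : R) : measurable A -> leb n A = q%:E ->
  rip A (cst z) (cst w) = rdot z w * q.
Proof. move=> mA Aq; transitivity (\int[leb n]_(x in A) (rdot z w))%R => //.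
by rewrite Rintegral_cst// [X in fine X]Aq. Qed.

(* The last term involves the real and imaginary parts of the integral of [u]
   over [A], as real inner products with [1] and ['i], so that [rip_Bessel]
   applies to it. *)
Lemma sqmod_mean_le A z u (q : R) : measurable A -> leb n A = q%:E -> L2 A u ->
  sqmod z * q ^+ 2 <= 4 * q * rip A (fun y => z - u y) (fun y => z - u y) +
    2 * (rip A u (cst 1) ^+ 2 + rip A u (cst 'i) ^+ 2).
Proof.
move=> mA Aq Lu; have Lz := L2_cst z mA Aq.
have L1 := L2_cst 1 mA Aq; have Li := L2_cst 'i mA Aq.
have LB : L2 A (fun y => z - u y) by exact: (L2B mA Lz Lu).
have := rip_CauchySchwarz mA LB L1; have := rip_CauchySchwarz mA LB Li.
set X := rip A (fun y => z - u y) (fun y => z - u y).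
rewrite !(ripBl mA Lz Lu)// !(rip_cst _ _ mA Aq).
set Y2 := rip A u (cst 'i); set Y1 := rip A u (cst 1).
case: z @X {LB Lz} => a b X; rewrite /rdot/sqmod/=.
rewrite !(mul0r, mulr0, mul1r, mulr1, addr0, add0r) => h2 h1.
(* These squares are the slack in [(a * q) ^+ 2 <= 2 * (a * q - Y1) ^+ 2 + 2 * Y1 ^+ 2] and in its
   analogue for [b]; Cauchy-Schwarz bounds each of the two differences by [X * q]. *)
have := sqr_ge0 (b * q - Y2 - Y2); have := sqr_ge0 (a * q - Y1 - Y1).
nra.
Qed.

(* The operator of averaging over [x + Q] is Hilbert-Schmidt, with squared norm
   [leb V / leb Q], and it is close to the identity on each [u i]. *)
Lemma orthonormal_size_le (I : eqType) (s : seq I) (u : I -> fn) V Q (v q : R) :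
  measurable V -> leb n V = v%:E -> measurable Q -> leb n Q = q%:E -> 0 < q ->
  (forall i, L2 setT (u i)) -> (forall i x, ~ V x -> u i x = 0) -> uniq s ->
  {in s &, forall i j, rip setT (u i) (u j) = (i == j)%:R} ->
  (forall i t, i \in s -> Q t ->
    (sqnorm setT (fun x => (u i (x + t) - u i x)%R) <= (8^-1)%:E)%E) ->
  (size s)%:R * q <= 8 * v.
Proof.
move=> mV Vv mQ Qq q0 Lu u0 us ou tau.
pose A x := [set y | Q (y - x)].
have mA x : measurable (A x).
  by rewrite -[X in measurable X]setTI; exact: measurable_translate.
have Aq x : leb n (A x) = q%:E by rewrite -Qq; exact: leb_translate.
(* The integral of [H i] is computed in both orders: over [t] first it is the local deviation of
   [u i] from its value at [x], over [x] first it is the norm of an increment, which [tau]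
   controls. *)
pose H i (p : 'rV[R]_n * 'rV[R]_n) : \bar R :=
  (\1_Q p.2 * sqmod (u i (p.1 + p.2) - u i p.1))%:E.
have H0 i p : (0 <= H i p)%E by rewrite lee_fin mulr_ge0// sqmod_ge0.
have mH i : measurable_fun setT (H i).
  have [ru iu _] := Lu i.
  have mw (w : 'rV[R]_n -> R) : measurable_fun setT w ->
      measurable_fun setT (fun p : 'rV[R]_n * 'rV[R]_n => w (p.1 + p.2) - w p.1).
    move=> mw; have M1 : measurable_fun setT
        (w \o (fun p : 'rV[R]_n * 'rV[R]_n => p.1 + p.2)).
      by apply: measurableT_comp => //; exact: measurable_add_rV.
    exact: measurable_funB M1 (measurableT_comp mw measurable_fst).
  apply/measurable_EFinP; apply: measurable_funM.
    exact: measurableT_comp (measurable_indic mQ) measurable_snd.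
  rewrite (_ : (fun _ => _) = fun p : 'rV[R]_n * 'rV[R]_n =>
      (complex.Re (u i (p.1 + p.2)) - complex.Re (u i p.1)) ^+ 2 +
      (complex.Im (u i (p.1 + p.2)) - complex.Im (u i p.1)) ^+ 2).
    by apply: measurable_funD; apply: measurable_funX; [exact: mw ru|exact: mw iu].
  by apply/funext => p; rewrite /sqmod !raddfB.
pose X i x := (\int[leb n]_t H i (x, t))%E.
have X0 i x : (0 <= X i x)%E by apply: integral_ge0.
have mX i : measurable_fun setT (X i).
  exact: (measurable_fun_fubini_tonelli_F (m2 := leb n) (H i)).
have LA i x : L2 (A x) (fun y => u i x - u i y).
  apply: (L2B (mA x) (L2_cst (u i x) (mA x) (Aq x))).
  exact: L2_setT_sub.
have XE i x : X i x =
    (rip (A x) (fun y => u i x - u i y) (fun y => u i x - u i y))%:E.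
  rewrite -sqnorm_rip// /sqnorm integral_mkcond.
  have m1 : measurable_fun setT
      ((fun y : 'rV[R]_n => (sqmod (u i x - u i y))%:E) \_ (A x)).
    apply/(measurable_restrict _ (mA x)) => //; rewrite setTI.
    exact: L2_sqmod_measurable (LA i x).
  rewrite -(ge0_integral_translate x m1); last first.
    by move=> y; rewrite patchE; case: ifP => // _; rewrite lee_fin sqmod_ge0.
  apply: eq_integral => t _; rewrite /H patchE indicE/= (addrC t x).
  rewrite (_ : (x + t \in A x) = (t \in Q)).
    by case: ifP; rewrite ?mul1r ?mul0r// -sqmodN opprB.
  by apply/idP/idP; rewrite !inE /A/= addrC addrA addNr add0r.
have XI i : i \in s -> (\int[leb n]_x X i x <= (q / 8)%:E)%E.
  move=> si; rewrite /X (fubini_tonelli (m1 := leb n) (m2 := leb n) (H i))//.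
  apply: (@le_trans _ _ (\int[leb n]_t ((8^-1)%:E * (\1_Q t)%:E))%E).
    apply: ge0_le_integral => //.
    - by move=> t _; apply: integral_ge0.
    - exact: (measurable_fun_fubini_tonelli_G (m1 := leb n) (H i)).
    - apply: measurable_funeM; exact/measurable_EFinP/measurable_indic.
    - move=> t _; rewrite indicE; have [tQ|tQ] := boolP (t \in Q).
        have Qt := set_mem tQ; rewrite mule1; apply: le_trans (tau i t si Qt); rewrite le_eqVlt.
        apply/orP; left; apply/eqP; apply: eq_integral => x _.
        by rewrite /H indicE/= mem_set// mul1r.
      rewrite mule0 integral0_eq// => x _.
      by rewrite /H indicE/= (negPf tQ) mul0r.
  rewrite ge0_integralZl_EFin//; last first.
    exact/measurable_EFinP/measurable_indic.
  rewrite integral_indic// setIT [X in (_ * X)%E]Qq -EFinM lee_fin.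
  by rewrite mulrC.
(* Bessel's inequality for the functions [1] and ['i] on [A x], each of squared norm [q], bounds the
   sum over [i] of the squared means by [2 * (q + q)], uniformly in [size s]. *)
have ptw x : (\sum_(i <- s) (sqmod (u i x) * q ^+ 2)%:E <=
    \sum_(i <- s) ((4 * q)%:E * X i x) + (4 * q)%:E)%E.
  rewrite [X in (_ <= X + _)%E](eq_bigr (fun i => (4 * q * rip (A x)
    (fun y => u i x - u i y) (fun y => u i x - u i y))%:E)); last first.
    by move=> i _; rewrite XE -EFinM.
  rewrite !sumEFin -EFinD lee_fin.
  have L1 := L2_zero_ext (mA x) (L2_cst 1 (mA x) (Aq x)).
  have Li := L2_zero_ext (mA x) (L2_cst 'i (mA x) (Aq x)).
  have B1 := rip_Bessel measurableT Lu L1 us ou.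
  have Bi := rip_Bessel measurableT Lu Li us ou.
  rewrite rip_zero_ext in B1; rewrite rip_zero_ext in Bi.
  have E1 z : rip (A x) (zero_ext (A x) (cst z)) (cst z) = rdot z z * q.
    by rewrite ripC rip_zero_ext2 (rip_cst _ _ (mA x) (Aq x)).
  rewrite E1 {1}/rdot/= !(mulr0, mulr1, addr0, add0r, mul1r) in B1.
  rewrite E1 {1}/rdot/= !(mulr0, mulr1, addr0, add0r, mul1r) in Bi.
  have : \sum_(i <- s) sqmod (u i x) * q ^+ 2 <= \sum_(i <- s)
      (4 * q * rip (A x) (fun y => u i x - u i y) (fun y => u i x - u i y) +
      2 * (rip (A x) (u i) (cst 1) ^+ 2 + rip (A x) (u i) (cst 'i) ^+ 2)).
    apply: ler_sum => i _; apply: sqmod_mean_le => //; exact: L2_setT_sub.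
  move=> /le_trans; apply; rewrite big_split/= lerD2l -mulr_sumr big_split/=.
  under eq_bigr do rewrite -rip_zero_ext.
  under [X in _ * (_ + X)]eq_bigr do rewrite -rip_zero_ext.
  by lra.
have Su i : i \in s -> (\int[leb n]_(x in V) (sqmod (u i x))%:E = 1)%E.
  move=> si; have LuV := L2_setT_sub mV (Lu i).
  have E : rip setT (u i) (u i) = rip V (u i) (u i).
    rewrite -(rip_zero_ext V); congr (rip setT (u i) _).
    apply/funext => x; rewrite /zero_ext; case: (boolP (x \in V)) => // xV.
    by apply: u0 => Vx; move/negP: xV; apply; rewrite inE.
  rewrite -[LHS]/(sqnorm V (u i)) sqnorm_rip// -E.
  by rewrite ou// eqxx.
have L : (\int[leb n]_(x in V) \sum_(i <- s) (sqmod (u i x) * q ^+ 2)%:E =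
    ((size s)%:R * q ^+ 2)%:E)%E.
  rewrite ge0_integral_sum//; last 2 first.
  - move=> i; apply/measurable_EFinP; apply: measurable_funM => //.
    by apply/measurable_EFinP; exact: L2_sqmod_measurable (L2_setT_sub mV (Lu i)).
  - by move=> i x _; rewrite lee_fin mulr_ge0 ?sqr_ge0 ?sqmod_ge0.
  rewrite big_seq (eq_bigr (fun=> (q ^+ 2)%:E)); last first.
    move=> i si; under eq_integral do rewrite mulrC EFinM.
    rewrite ge0_integralZl_EFin ?Su ?mule1 ?sqr_ge0//.
    - by move=> x _; rewrite lee_fin sqmod_ge0.
    - exact: L2_sqmod_measurable (L2_setT_sub mV (Lu i)).
  rewrite -big_seq sumEFin; congr EFin.
  by rewrite big_const_seq count_predT iter_addr_0 mulr_natl.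
have c0 : 0 <= 4 * q by rewrite mulr_ge0 ?ltW.
have mXV i : measurable_fun V (fun x => (4 * q)%:E * X i x)%E.
  by apply: measurable_funeM; exact: measurable_funTS.
have cX0 i x : (0 <= (4 * q)%:E * X i x)%E by rewrite mule_ge0.
have U : (\int[leb n]_(x in V) (\sum_(i <- s) ((4 * q)%:E * X i x) + (4 * q)%:E) <=
    ((size s)%:R * (4 * q * (q / 8)) + 4 * q * v)%:E)%E.
  rewrite ge0_integralD//; last 2 first.
  - by move=> x _; apply: sume_ge0.
  - by apply: emeasurable_sum => i.
  rewrite [X in (_ + X)%E](_ : _ = (4 * q * v)%:E); last first.
    by rewrite (_ : (fun _ => _) = cst (4 * q)%:E)// integral_cst// [X in (_ * X)%E]Vv.
  rewrite EFinD leeD2r// ge0_integral_sum//.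
  apply: (@le_trans _ _ (\sum_(i <- s) (4 * q * (q / 8))%:E)%E); last first.
    by rewrite sumEFin lee_fin big_const_seq count_predT iter_addr_0 -[leLHS]mulr_natl.
  rewrite big_seq [leRHS]big_seq; apply: lee_sum => i si.
  rewrite ge0_integralZl//; last exact: measurable_funTS.
  rewrite [leRHS]EFinM lee_wpmul2l ?lee_fin//; apply: le_trans (XI i si).
  exact: ge0_subset_integral.
have : ((size s)%:R * q ^+ 2 <= (size s)%:R * (4 * q * (q / 8)) + 4 * q * v).
  rewrite -lee_fin -L; apply: le_trans U; apply: ge0_le_integral => //.
  - by move=> x _; apply: sume_ge0 => i _; rewrite lee_fin mulr_ge0 ?sqr_ge0 ?sqmod_ge0.
  - apply: emeasurable_sum => i; apply/measurable_EFinP.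
    apply: measurable_funM => //.
    by apply/measurable_EFinP; exact: L2_sqmod_measurable (L2_setT_sub mV (Lu i)).
  - by apply: emeasurable_funD => //; apply: emeasurable_sum => i.
(* The threshold [8^-1] turns the first term on the right into half of the left side, where it is
   absorbed. *)
rewrite expr2 => H1; have : 0 <= q * (8 * v - (size s)%:R * q) by lra.
by rewrite pmulr_rge0// subr_ge0.
Qed.

End counting.

Section H10_counting.
Context {R : realType} {n : nat}.
Local Notation fn := ('rV[R]_n -> R[i]).

(** With cubes of side [h = 1 / M], the hypothesis on [M] says that
    [2 ^+ n.+2 * h ^+ 2 * G <= 1 / 8]: the normalized functions meet the threshold of
    [orthonormal_size_le]. *)
Lemma H10_orthogonal_size_le (I : eqType) (s : seq I) (Omega : set 'rV[R]_n)
    (u : I -> fn) (Du : I -> 'I_n -> fn) (G v : R) (M : nat) :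
  measurable Omega -> leb n Omega = v%:E -> (0 < M)%N ->
  2 ^+ n.+2 * 8 * G <= M%:R ^+ 2 -> uniq s ->
  {in s, forall i, H10 Omega (u i) (Du i)} ->
  {in s, forall i, 0 < rip Omega (u i) (u i)} ->
  {in s &, forall i j, i != j -> rip Omega (u i) (u j) = 0} ->
  {in s, forall i, (\sum_(k < n) sqnorm Omega (Du i k) <=
                    (G * rip Omega (u i) (u i))%:E)%E} ->
  (size s)%:R <= 8 * v * M%:R ^+ n.
Proof.
move=> mO Ov M0 GM us Hu up uo uG.
have M0' : 0 < M%:R :> R by rewrite ltr0n.
pose h : R := M%:R^-1; have h0 : 0 < h by rewrite invr_gt0.
pose Q := [set t : 'rV[R]_n | forall i : 'I_n, `[0, h]%classic (t ord0 i)].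
have mQ : measurable Q.
  by apply: (@measurable_box _ _ (fun=> `[0, h]%classic)) => i; exact: measurable_itv.
have Qq : leb n Q = (h ^+ n)%:E.
  rewrite /Q (@leb_box _ _ (fun=> `[0, h]%classic)); last first.
    by move=> i; exact: measurable_itv.
  rewrite (_ : lebesgue_measure `[0, h]%classic = h%:E); last first.
    by rewrite lebesgue_measure_itv/= lte_fin h0 sube0.
  elim: (n) => [|m IHm]; first by rewrite big_ord0.
  by rewrite big_ord_recl IHm exprS EFinM.
pose c i := (Num.sqrt (rip Omega (u i) (u i)))^-1.
(* The value 0 off [s] is there because [orthonormal_size_le] wants every member of the family in
   [L2]. *)
pose w i := if i \in s then rscale (c i) (zero_ext Omega (u i)) else fun=> 0.
have Lu i : i \in s -> L2 Omega (u i) by move=> /Hu[[]].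
have Lz i : i \in s -> L2 setT (zero_ext Omega (u i)).
  by move=> si; apply: L2_zero_ext => //; exact: Lu.
have zz i j : rip setT (zero_ext Omega (u i)) (zero_ext Omega (u j)) =
    rip Omega (u i) (u j).
  by rewrite rip_zero_ext ripC rip_zero_ext2 ripC.
have cE i : i \in s -> c i ^+ 2 * rip Omega (u i) (u i) = 1.
  move=> si; rewrite /c exprVn sqr_sqrtr; last exact/ltW/up.
  by rewrite mulVf// gt_eqF// up.
suff : (size s)%:R * h ^+ n <= 8 * v.
  rewrite -ler_pdivlMr ?exprn_gt0// => /le_trans; apply.
  by rewrite /h exprVn invrK.
apply: (@orthonormal_size_le _ _ _ s w Omega Q) => //.
- by rewrite exprn_gt0.
- move=> i; rewrite /w; case: (boolP (i \in s)) => si; last exact: L2_0.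
  by apply: L2Z => //; exact: Lz.
- move=> i x nO; rewrite /w; case: ifP => // _; rewrite /rscale /zero_ext.
  by rewrite memNset// mulr0.
- move=> i j si sj; rewrite /w si sj ripZl ?ripZr ?zz//; last 4 first.
    exact: Lz.
    exact: Lz.
    exact: Lz.
    by apply: L2Z => //; exact: Lz.
  have [<-|ij] := eqVneq i j; first by rewrite mulrA -expr2 cE.
  by rewrite uo// !mulr0.
- move=> i t si Qt; rewrite /w si.
  have mU := cmeasurable_zero_ext mO (L2_cmeasurable (Lu i si)).
  pose d x := zero_ext Omega (u i) (x + t) - zero_ext Omega (u i) x.
  have md : cmeasurable setT d.
    by apply: cmeasurableB => //; exact: cmeasurable_translate.
  have -> : (fun x => rscale (c i) (zero_ext Omega (u i)) (x + t) -
      rscale (c i) (zero_ext Omega (u i)) x) = rscale (c i) d.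
    by apply/funext => x; rewrite /rscale /d mulrBr.
  rewrite sqnormZ//.
  have Qt' k : 0 <= t ord0 k <= h by have := Qt k; rewrite /= in_itv/=.
  apply: (@le_trans _ _ ((c i ^+ 2)%:E * ((2 ^+ n.+2 * h ^+ 2)%:E *
      (G * rip Omega (u i) (u i))%:E))%E).
    rewrite lee_wpmul2l ?lee_fin ?sqr_ge0//.
    apply: le_trans (H10_translate_le mO (Hu i si) Qt') _.
    apply: lee_wpmul2l; last exact: uG.
    by rewrite lee_fin mulr_ge0 ?exprn_ge0 ?ltW.
  rewrite -!EFinM lee_fin.
  have -> : c i ^+ 2 * (2 ^+ n.+2 * h ^+ 2 * (G * rip Omega (u i) (u i))) =
      2 ^+ n.+2 * G * h ^+ 2 * (c i ^+ 2 * rip Omega (u i) (u i)) by ring.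
  rewrite cE// mulr1 /h exprVn ler_pdivrMr ?exprn_gt0//.
  have : 8 * (2 ^+ n.+2 * G) <= M%:R ^+ 2.
    by apply: le_trans GM; rewrite mulrA (mulrC 8).
  by set a := 2 ^+ n.+2 * G; lra.
Qed.

End H10_counting.

(** * Uniform ellipticity on the closure of the domain *)

Lemma continuous_sumr {R : realType} (T : topologicalType) (I : Type) (s : seq I)
    (f : I -> T -> R) : (forall i, continuous (f i)) ->
  continuous (fun x => \sum_(i <- s) f i x).
Proof.
move=> cf; elim: s => [|i s IHs] x.
  by under eq_fun do rewrite big_nil; exact: cvg_cst.
under eq_fun do rewrite big_cons.
by apply: cvgD; [exact: cf|exact: IHs].
Qed.

Section coercivity.
Context {R : realType} {n : nat}.
Variables (Omega : set 'rV[R]_n) (g : 'rV[R]_n -> 'M[R]_n).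
Hypothesis Omega_bounded : bounded_set Omega.
Hypothesis g_smooth : forall j k, smooth_on_closure Omega (fun x => g x j k).
Hypothesis g_pos : forall x, closure Omega x -> forall xi : 'rV[R]_n, xi != 0 ->
  0 < (xi *m g x *m xi^T) ord0 ord0.

Lemma compact_closure_bounded : compact (closure Omega).
Proof.
apply: bounded_closed_compact; last exact: closed_closure.
case: Omega_bounded => M [_ /(_ (M + 1) (ltr_pwDr ltr01 (lexx M)))] /= OM.
have cM : closed [set x : 'rV[R]_n | `|x| <= M + 1].
  apply: (@closed_comp _ _ (fun x : 'rV[R]_n => `|x|) [set r | r <= M + 1]).
    by move=> x _; exact: norm_continuous.
  exact: closed_le.
have OM' : closure Omega `<=` [set x : 'rV[R]_n | `|x| <= M + 1].
  by rewrite closureE => x; apply; split.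
exists (M + 1); split; first exact: num_real.
by move=> r Mr x /OM' /= /le_trans; apply; exact: ltW.
Qed.

Lemma quadratic_formE (A : 'M[R]_n) (xi : 'rV[R]_n) :
  (xi *m A *m xi^T) ord0 ord0 =
  \sum_j \sum_k A j k * xi ord0 k * xi ord0 j.
Proof.
rewrite mxE exchange_big/=; apply: eq_bigr => k _.
rewrite !mxE mulr_suml; apply: eq_bigr => j _; ring.
Qed.

(** The constant is the minimum of the quadratic form on the compact product of [closure Omega] with
    the Euclidean unit sphere; homogeneity extends the bound to all [xi]. Continuity is that of the
    smooth extensions [F j k] of the coefficients. *)
Lemma coercive : exists2 c : R, 0 < c & forall x, closure Omega x ->
  forall xi : 'rV[R]_n, c * \sum_i xi ord0 i ^+ 2 <=
    \sum_j \sum_k g x j k * xi ord0 k * xi ord0 j.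
Proof.
have [F FE] : exists F : 'I_n -> 'I_n -> 'rV[R]_n -> R, forall j k,
    continuous (F j k) /\ {in closure Omega, (fun x => g x j k) =1 F j k}.
  have H (p : 'I_n * 'I_n) : exists F : 'rV[R]_n -> R, continuous F /\
      {in closure Omega, (fun x => g x p.1 p.2) =1 F}.
    have [F sF gF] := g_smooth p.1 p.2; exists F; split => //.
    exact: smooth_continuous.
  have [F FE] := choice H.
  by exists (fun j k => F (j, k)) => j k; have := FE (j, k).
pose q (p : 'rV[R]_n * 'rV[R]_n) : R :=
  \sum_j \sum_k F j k p.1 * p.2 ord0 k * p.2 ord0 j.
have coordc (k : 'I_n) : continuous (fun p : 'rV[R]_n * 'rV[R]_n => p.2 ord0 k).
  move=> p; apply: (@continuous_comp _ _ _ snd (fun x : 'rV[R]_n => x ord0 k)).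
    exact: cvg_snd.
  exact: coord_continuous.
have cq : continuous q.
  apply: continuous_sumr => j; apply: continuous_sumr => k p.
  apply: cvgM; last exact: coordc.
  apply: cvgM; last exact: coordc.
  apply: (@continuous_comp _ _ _ fst (F j k)); first exact: cvg_fst.
  by have [+ _] := FE j k; apply.
pose S := [set xi : 'rV[R]_n | \sum_i xi ord0 i ^+ 2 = 1].
have cS : compact S.
  apply: bounded_closed_compact.
    exists 1; split; first exact: num_real.
    move=> r r1 xi Sxi; apply: le_trans (ltW r1).
    rewrite [leLHS]/Num.norm/= mx_normrE; apply/bigmax_leP; split => //= -[i j] _ /=.
    rewrite (ord1 i) -(@ler_pXn2r _ 2)// ?nnegrE// expr1n real_normK ?num_real//.
    rewrite -Sxi (bigD1 j)//= lerDl; apply: sumr_ge0 => k _; exact: sqr_ge0.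
  apply: (@closed_comp _ _ (fun xi : 'rV[R]_n => \sum_i xi ord0 i ^+ 2) [set 1]).
    move=> x _; apply: continuous_sumr => j y.
    have cj : continuous (fun y : 'rV[R]_n => y ord0 j : R) by exact: coord_continuous.
    by under eq_fun do rewrite expr2; exact: cvgM (cj y) (cj y).
  exact: closed_eq.
have scale (x xi : 'rV[R]_n) (c : R) : closure Omega x ->
    (forall xi, S xi -> c <= q (x, xi)) -> c * \sum_i xi ord0 i ^+ 2 <=
    \sum_j \sum_k g x j k * xi ord0 k * xi ord0 j.
  move=> Ox cq'; set N := \sum_i xi ord0 i ^+ 2.
  have N0 : 0 <= N by apply: sumr_ge0 => i _; exact: sqr_ge0.
  have qE : \sum_j \sum_k g x j k * xi ord0 k * xi ord0 j = q (x, xi).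
    apply: eq_bigr => j _; apply: eq_bigr => k _ /=.
    by have [_ /(_ x)/= ->] := FE j k; rewrite ?inE.
  have [NE|NE] := eqVneq N 0.
    have xi0 i : xi ord0 i = 0.
      move/eqP: NE; rewrite psumr_eq0; last by move=> k _; exact: sqr_ge0.
      by move=> /allP/(_ i); rewrite mem_index_enum sqrf_eq0 => /(_ isT)/eqP.
    rewrite NE mulr0 [leRHS]big1// => j _; apply: big1 => k _.
    by rewrite (xi0 j) mulr0.
  have Np : 0 < N by rewrite lt_def NE.
  pose eta : 'rV[R]_n := (Num.sqrt N)^-1 *: xi.
  have s2 : (Num.sqrt N)^-1 ^+ 2 = N^-1 by rewrite exprVn sqr_sqrtr.
  have Seta : S eta.
    rewrite /S/= -[RHS](mulVf NE) -s2 mulr_sumr; apply: eq_bigr => i _.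
    by rewrite mxE exprMn.
  rewrite qE; have := cq' _ Seta.
  have -> : q (x, eta) = N^-1 * q (x, xi).
    rewrite /q mulr_sumr; apply: eq_bigr => j _; rewrite mulr_sumr.
    by apply: eq_bigr => k _; rewrite /= !mxE -s2; ring.
  by rewrite mulrC ler_pdivlMr.
(* There is no minimum when [Omega] is empty or [n = 0]; any constant is then correct. *)
have [E|/set0P A0] := eqVneq (closure Omega `*` S) set0.
  exists 1 => // x Ox xi; apply: scale => // eta Seta.
  by have : (closure Omega `*` S) (x, eta) by []; rewrite E.
have [p + pmin] := compact_EVT_min A0
  (compact_setX compact_closure_bounded cS) (continuous_subspaceT cq).
rewrite inE => -[pO pS].
exists (q p); last first.
  move=> x Ox xi; apply: scale => // eta Seta; apply: pmin.
  by rewrite inE.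
have qE : q p = (p.2 *m g p.1 *m (p.2)^T) ord0 ord0.
  rewrite quadratic_formE; apply: eq_bigr => j _; apply: eq_bigr => k _.
  by have [_ /(_ p.1)/= ->] := FE j k; rewrite ?inE.
rewrite qE; apply: g_pos => //; apply/eqP => p20.
move: pS; rewrite /S/= p20 big1 ?(@eq_sym _ 0) => [/eqP|i _].
  by rewrite eq_sym oner_eq0.
by rewrite mxE expr0n.
Qed.

End coercivity.

(** * The Dirichlet operator *)

Section dirichlet.
Context {R : realType} {n : nat}.
Local Notation fn := ('rV[R]_n -> R[i]).
Implicit Types (u v w : fn).
Variables (Omega : set 'rV[R]_n) (g : 'rV[R]_n -> 'M[R]_n).
Hypothesis Omega_open : open Omega.
Hypothesis Omega_bounded : bounded_set Omega.
Hypothesis g_smooth : forall j k, smooth_on_closure Omega (fun x => g x j k).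
Hypothesis g_sym : forall x, closure Omega x -> (g x)^T = g x.
Hypothesis g_pos : forall x, closure Omega x -> forall xi : 'rV[R]_n, xi != 0 ->
  0 < (xi *m g x *m xi^T) ord0 ord0.

Let mO : measurable Omega. Proof. exact: open_measurable_rV. Qed.

Let A := dirichlet_operator Omega g.

Definition energy (Du Dv : 'I_n -> fn) : R := (\int[leb n]_(x in Omega)
  \sum_(j < n) \sum_(k < n) g x j k * rdot (Du k x) (Dv j x))%R.

Lemma Re_dirichlet_form Du Dv :
  complex.Re (dirichlet_form Omega g Du Dv) = energy Du Dv.
Proof.
apply: eq_Rintegral => x _; rewrite raddf_sum; apply: eq_bigr => j _.
rewrite raddf_sum; apply: eq_bigr => k _.
by case: (Du k x) (Dv j x) => [a b] [c d]; rewrite /rdot/=; ring.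
Qed.

Lemma energyC Du Dv : energy Du Dv = energy Dv Du.
Proof.
apply: eq_Rintegral => x /set_mem Ox; rewrite exchange_big/=.
apply: eq_bigr => j _; apply: eq_bigr => k _; rewrite rdotC; congr (_ * _).
by rewrite -[in LHS](g_sym (subset_closure Ox)) mxE.
Qed.

Lemma g_measurable j k : measurable_fun Omega (fun x => g x j k).
Proof.
have [F sF gF] := g_smooth j k.
apply: (eq_measurable_fun F) => [x /set_mem Ox|].
  by rewrite gF// inE; exact: subset_closure.
by apply: continuous_measurable_rV => // x _; exact: smooth_continuous.
Qed.

Lemma g_bounded j k : [bounded g x j k | x in Omega].
Proof.
have [F sF gF] := g_smooth j k.
have /compact_bounded[M [Mr HM]] : compact (F @` closure Omega).
  apply: continuous_compact; last exact: compact_closure_bounded.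
  by apply: continuous_subspaceT => x; exact: smooth_continuous.
exists M; split => // r Mr' x Ox /=.
have cO := subset_closure Ox.
by rewrite gF ?inE//; apply: (HM r Mr'); exists x.
Qed.

Lemma energy_ge : exists2 c : R, 0 < c & forall Du, (forall i, L2 Omega (Du i)) ->
  c * \sum_(i < n) rip Omega (Du i) (Du i) <= energy Du Du.
Proof.
have [c c0 cg] := coercive Omega_bounded g_smooth g_pos.
exists c => // Du LDu.
have isum (I : Type) (r : seq I) (f : I -> 'rV[R]_n -> R) :
    (forall i, (leb n).-integrable Omega (EFin \o f i)) ->
    (leb n).-integrable Omega (EFin \o (fun x => \sum_(i <- r) f i x)).
  move=> fi; rewrite (_ : _ \o _ = fun x => (\sum_(i <- r) (EFin \o f i) x)%E).
    exact: integrable_sum.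
  by apply/funext => x; rewrite /= sumEFin.
have iD i k : (leb n).-integrable Omega (EFin \o (fun x => rdot (Du i x) (Du k x))).
  exact: rdot_integrable.
have iS : (leb n).-integrable Omega
    (EFin \o (fun x => c * \sum_(i < n) rdot (Du i x) (Du i x))).
  rewrite (_ : _ \o _ =
      fun x => (c%:E * (EFin \o (fun x => \sum_i rdot (Du i x) (Du i x))%R) x)%E).
    by apply: integrableZl => //; apply: (isum).
  by apply/funext => x; rewrite /= EFinM.
have iE : (leb n).-integrable Omega (EFin \o (fun x =>
    \sum_(j < n) \sum_(k < n) g x j k * rdot (Du k x) (Du j x))).
  apply: (isum) => j; apply: (isum) => k.
  rewrite (_ : _ \o _ = ((EFin \o (fun x => g x j k)) \*
      (EFin \o (fun x => rdot (Du k x) (Du j x))))%E); last first.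
    by apply/funext => x; rewrite /= EFinM.
  by apply: integrableMr => //; [exact: g_measurable|exact: g_bounded].
have -> : c * \sum_(i < n) rip Omega (Du i) (Du i) = (\int[leb n]_(x in Omega)
    (c * \sum_(i < n) rdot (Du i x) (Du i x)))%R.
  rewrite RintegralZl//; last by apply: (isum).
  congr (_ * _); elim: (index_enum _) => [|i r IHr].
    by rewrite big_nil /Rintegral; under eq_integral do rewrite big_nil;
       rewrite integral0.
  rewrite big_cons IHr -RintegralD//; last by apply: (isum).
  by apply: eq_Rintegral => x _; rewrite big_cons.
apply: le_Rintegral => // x Ox; have cO := subset_closure Ox.
(* The coefficients are real, so the form of a complex gradient is the sum of those of its real and
   imaginary parts. *)
pose a : 'rV[R]_n := \row_i complex.Re (Du i x).
pose b : 'rV[R]_n := \row_i complex.Im (Du i x).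
have := lerD (cg x cO a) (cg x cO b).
rewrite -mulrDr -!big_split/=.
rewrite (eq_bigr (fun i => rdot (Du i x) (Du i x))); last first.
  by move=> i _; rewrite !mxE /rdot !expr2.
move=> /le_trans; apply; rewrite le_eqVlt; apply/orP; left; apply/eqP.
apply: eq_bigr => j _; rewrite -big_split/=; apply: eq_bigr => k _.
by rewrite !mxE /rdot; ring.
Qed.

Lemma dirichlet_L2 u w : A u w -> L2 Omega u /\ L2 Omega w.
Proof. by move=> [Lw [Du [[Lu _] _] _]]. Qed.

Lemma dirichlet_sym u w v z : A u w -> A v z -> rip Omega w v = rip Omega u z.
Proof.
move=> [Lw [Du Hu uw]] [Lz [Dv Hv vz]].
rewrite -Re_inner -(uw v Dv Hv) Re_dirichlet_form energyC -Re_dirichlet_form.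
by rewrite (vz u Du Hu) Re_inner ripC.
Qed.

Lemma dirichlet_ge0 u w : A u w -> 0 <= rip Omega w u.
Proof.
move=> [Lw [Du Hu uw]]; rewrite -Re_inner -(uw u Du Hu) Re_dirichlet_form.
have [c c0 cE] := energy_ge.
have LDu i : L2 Omega (Du i) by have [[_ /(_ i)[]]] := Hu.
apply: le_trans (cE Du LDu).
by apply: mulr_ge0; [exact: ltW|apply: sumr_ge0 => i _; exact: rip_ge0].
Qed.

(** The defining equation involves the full complex inner product; its imaginary part is the real
    inner product with ['i * v], so both parts are insensitive to null sets. *)
Lemma dirichlet_ae u w w' : A u w -> L2 Omega w' ->
  w = w' %[ae leb n in Omega] -> A u w'.
Proof.
move=> [Lw [Du Hu uw]] Lw' ww'; split => //; exists Du => // v Dv Hv.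
rewrite (uw v Dv Hv); have Lv : L2 Omega v by have [[]] := Hv.
have LiV : L2 Omega (fun x => 'i * v x).
  case: Lv => rv iv voo; split.
  - rewrite (_ : (fun _ => _) = (fun x => - complex.Im (v x))).
      exact: measurable_funN.
    by apply/funext => x; case: (v x) => a b /=; ring.
  - rewrite (_ : (fun _ => _) = (fun x => complex.Re (v x)))//.
    by apply/funext => x; case: (v x) => a b /=; ring.
  - rewrite (_ : sqnorm _ _ = sqnorm Omega v)//; apply: eq_integral => x _.
    by case: (v x) => a b; rewrite /sqmod/=; congr EFin; ring.
have Im_inner z : complex.Im (inner Omega z v) = rip Omega z (fun x => 'i * v x).
  rewrite /inner /cintegral /rip /=; apply: eq_Rintegral => x _.
  by case: (z x) (v x) => [a b] [c d]; rewrite /rdot/=; ring.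
apply/eqP; rewrite eq_complex !Re_inner !Im_inner.
by rewrite (rip_congr mO Lw Lw' Lv ww') (rip_congr mO Lw Lw' LiV ww') !eqxx.
Qed.

(** Coercivity turns the bound [m] on the quotients of [A] into a bound [m / c] on the gradients.
    The cubes then have side [1 / (K0 * m)]; a side of order [m] to the power -1/2 would give the
    exponent [n / 2], but only finiteness and the logarithm of the count matter below. *)
Lemma dirichlet_size_le : exists K : nat, forall (I : eqType) (s : seq I)
    (u w : I -> fn) (m : nat), (0 < m)%N -> uniq s ->
  {in s, forall i, A (u i) (w i)} ->
  {in s, forall i, 0 < rip Omega (u i) (u i)} ->
  {in s, forall i, rip Omega (w i) (u i) <= m%:R * rip Omega (u i) (u i)} ->
  {in s &, forall i j, i != j -> rip Omega (u i) (u j) = 0} ->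
  (size s <= K * m ^ n)%N.
Proof.
have [c c0 cE] := energy_ge.
have [v Ov] : exists v : R, leb n Omega = v%:E.
  exists (fine (leb n Omega)); rewrite fineK// ge0_fin_numE//.
  exact: leb_bounded_lty.
have v0 : 0 <= v by rewrite -lee_fin -Ov measure_ge0.
(* Since [K0] and [m] are at least 1, their squares dominate them, and [M = K0 * m] meets the
   condition of [H10_orthogonal_size_le]. *)
pose K0 := (Num.truncn (2 ^+ n.+2 * 8 / c)).+1.
have K0c : 2 ^+ n.+2 * 8 / c <= K0%:R.
  by apply: ltW; rewrite truncnS_gt.
pose K := (Num.truncn (8 * v * K0%:R ^+ n)).+1.
exists K => I s u w m m0 us Auw up um ou.
rewrite -(ler_nat R) natrM natrX.
apply: (@le_trans _ _ (8 * v * K0%:R ^+ n * m%:R ^+ n)); last first.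
  by rewrite ler_wpM2r ?exprn_ge0// ltW// truncnS_gt.
have HDu i : exists Du, i \in s -> H10 Omega (u i) Du /\
    c * \sum_(k < n) rip Omega (Du k) (Du k) <= rip Omega (w i) (u i).
  have [si|] := boolP (i \in s); last by exists (fun=> fun=> 0).
  have [Lw [Du Hu uw]] := Auw i si; exists Du => _; split => //.
  rewrite -Re_inner -(uw (u i) Du Hu) Re_dirichlet_form; apply: cE => k.
  by have [[_ /(_ k)[]]] := Hu.
have [Du DuE] := choice HDu.
rewrite -mulrA -exprMn -natrM.
apply: (@H10_orthogonal_size_le _ _ _ s Omega u Du (m%:R / c) v) => //.
- by rewrite muln_gt0 m0.
- rewrite natrM exprMn mulrCA.
  have K1 : 1 <= K0%:R :> R by rewrite ler1n.
  have m1 : 1 <= m%:R :> R by rewrite ler1n.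
  rewrite (mulrC (K0%:R ^+ 2)); apply: ler_pM => //.
  + by apply: divr_ge0; [apply: mulr_ge0 => //; exact: exprn_ge0|exact: ltW].
  + by rewrite -[leLHS]expr1 ler_weXn2l.
  + by apply: le_trans K0c _; rewrite -[leLHS]expr1 ler_weXn2l.
- by move=> i si; have [] := DuE i si.
- move=> i si; have [Hu cD] := DuE i si.
  have LDu k : L2 Omega (Du i k) by have [[_ /(_ k)[]]] := Hu.
  under eq_bigr do rewrite (sqnorm_rip (LDu _)).
  rewrite sumEFin lee_fin mulrAC ler_pdivlMr// mulrC.
  by apply: le_trans cD _; exact: um.
Qed.

End dirichlet.

(** * Measures on the line charging finitely many points *)

Section finite_support.
Context {R : realType}.

Lemma uniq_size_finite (T : eqType) (X : set T) (N : nat) :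
  (forall s : seq T, uniq s -> {in s, forall x, X x} -> (size s <= N)%N) ->
  exists2 S : seq T, uniq S & forall x, X x <-> x \in S.
Proof.
move=> XN; pose p k := `[< exists s : seq T,
  [/\ uniq s, {in s, forall x, X x} & size s = k] >].
have ex : exists k, p k by exists 0%N; apply/asboolP; exists [::].
have pN k : p k -> (k <= N)%N.
  by move=> /asboolP[s [us sX <-]]; exact: XN.
have [k /asboolP[s [us sX sk]] kmax] := ex_maxnP ex pN.
exists s => // x; split; last exact: sX.
move=> Xx; apply: contrapT => /negP xs.
have : p (size s).+1.
  apply/asboolP; exists (x :: s); split => //=; first by rewrite xs.
  by move=> y; rewrite inE => /predU1P[->//|/sX].
by move=> /kmax; rewrite sk ltnn.
Qed.

Lemma separated_seq (s : seq R) : exists2 e : R, 0 < e &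
  {in s &, forall x y, x != y -> e + e <= `|x - y|}.
Proof.
have minpos (l : seq R) : {in l, forall z, 0 < z} ->
    exists2 e : R, 0 < e & {in l, forall z, e <= z}.
  elim: l => [_|a l IHl al]; first by exists 1.
  have [|e e0 el] := IHl; first by move=> z zl; apply: al; rewrite inE zl orbT.
  exists (Num.min a e); first by rewrite lt_min e0 al// mem_head.
  by move=> z; rewrite inE ge_min => /predU1P[->|/el->]; rewrite ?lexx ?orbT.
have [|e e0 el] := minpos [seq `|p.1 - p.2| / 2 | p <- [seq (x, y) | x <- s, y <- s]
    & p.1 != p.2].
  move=> z /mapP[p]; rewrite mem_filter => /andP[pq _] ->.
  by rewrite divr_gt0// normr_gt0 subr_eq0.
exists e => // x y xs ys xy.
have : e <= `|x - y| / 2.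
  apply: el; apply/mapP; exists (x, y) => //; rewrite mem_filter xy/=.
  by apply/allpairsP; exists (x, y).
lra.
Qed.

Lemma set_mem_cons (T : eqType) (a : T) (s : seq T) :
  [set` a :: s] = [set a] `|` [set` s].
Proof.
apply/seteqP; split => x /=; rewrite inE.
  by move=> /predU1P[]; [left|right].
by move=> [->|->]; rewrite ?eqxx ?orbT.
Qed.

Lemma null_seq (nu : {measure set R -> \bar R}) (s : seq R) :
  {in s, forall x, nu [set x] = 0%E} -> nu.-negligible [set` s].
Proof.
elim: s => [_|a s IHs as0].
  by rewrite classical_sets.set_nil; exact: negligible_set0.
rewrite set_mem_cons; apply: negligibleU.
  by apply/negligibleP => //; apply: as0; rewrite mem_head.
by apply: IHs => x xs; apply: as0; rewrite inE xs orbT.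
Qed.

Lemma measurable_seq (s : seq R) : measurable [set` s].
Proof.
elim: s => [|a s IHs]; first by rewrite classical_sets.set_nil; exact: measurable0.
by rewrite set_mem_cons; apply: measurableU.
Qed.

Lemma measure_seq_le (nu : {measure set R -> \bar R}) (s : seq R) :
  (nu [set` s] <= \sum_(x <- s) nu [set x])%E.
Proof.
elim: s => [|a s IHs]; first by rewrite classical_sets.set_nil measure0 big_nil.
rewrite set_mem_cons big_cons; apply: le_trans (leeD2l _ IHs).
by apply: measureU2 => //; exact: measurable_seq.
Qed.

(* The points all of whose neighbourhoods charge [D] have disjoint charged
   neighbourhoods, so they are at most [N]; the rest is covered by countably
   many null balls. *)
Lemma finite_support (nu : {measure set R -> \bar R}) (D : set R) (N : nat) :
  measurable D ->
  (forall (s : seq R) (B : R -> set R), uniq s ->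
    {in s, forall x, [/\ measurable (B x), B x `<=` D & nu (B x) != 0%E]} ->
    {in s &, forall x y, x != y -> B x `&` B y = set0} -> (size s <= N)%N) ->
  exists S : seq R, nu.-negligible (D `\` [set` S]).
Proof.
move=> mD sN.
pose X := [set x | forall e : R, 0 < e -> nu (ball x e `&` D) != 0%E].
have mball x e : measurable (ball x e `&` D).
  by apply: measurableI => //; apply: open_measurable; exact: ball_open.
have [S uS XS] : exists2 S : seq R, uniq S & forall x, X x <-> x \in S.
  apply: (@uniq_size_finite _ _ N) => s us sX.
  have [e e0 se] := separated_seq s.
  apply: (sN s (fun x => ball x e `&` D)) => //.
    by move=> x xs; split => //; exact: sX.
  move=> x y xs ys xy; rewrite -subset0 => z [[xz _] [yz _]].
  have := se x y xs ys xy; rewrite leNgt => /negP; apply.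
  rewrite -(subrKA z); apply: le_lt_trans (ler_normD _ _) _.
  by apply: ltrD => //; rewrite distrC.
exists S.
pose F (p : rat * nat) := ball (ratr p.1 : R) p.2.+1%:R^-1 `&` D.
(* [negligible_bigcup] runs over [nat], so the rational balls are enumerated by their codes; numbers
   coding no ball, or a charged one, give the empty set. *)
pose G k := if unpickle k is Some p then
  (if nu (F p) == 0%E then F p else set0) else set0.
have G0 k : nu.-negligible (G k).
  rewrite /G; case: unpickle => [p|]; last exact: negligible_set0.
  case: eqP => [Fp|_]; last exact: negligible_set0.
  by apply/negligibleP => //; exact: mball.
apply: negligibleS (negligible_bigcup G0) => x [Dx /= xS].
have /existsNP[e /not_implyP[e0 /negP/negPn/eqP nu0]] : ~ X x by move=> /XS.
have [k ke] : exists k : nat, k.+1%:R^-1 + k.+1%:R^-1 < e.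
  have [k _ /(_ k (leqnn k))/= ke] :=
    near_infty_natSinv_lt (PosNum (divr_gt0 e0 (ltr0Sn R 1))).
  by exists k; rewrite (splitr e) ltrD.
have k0 : 0 < k.+1%:R^-1 :> R by rewrite invr_gt0.
have [q] := @rat_in_itvoo R x _ (ltr_pwDr k0 (lexx x)).
rewrite in_itv/= => /andP[q1 q2].
have qx : ball (ratr q : R) k.+1%:R^-1 x.
  by rewrite /ball/= gtr0_norm ?subr_gt0// ltrBlDl.
have Fqk : nu (F (q, k)) = 0%E.
  apply/le_anti; rewrite measure_ge0 andbT.
  rewrite -nu0; apply: le_measure; rewrite ?inE; [exact: mball|exact: mball|].
  move=> y [qy Dy]; split => //; apply: lt_trans ke => /=.
  rewrite -(subrKA (ratr q)); apply: le_lt_trans (ler_normD _ _) _.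
  by apply: ltrD => //; rewrite distrC.
have GE : G (pickle (q, k)) = F (q, k) by rewrite /G pickleK Fqk eqxx.
have Gx : G (pickle (q, k)) x by rewrite GE; split.
by clear GE; move: (pickle (q, k)) Gx => m Gm; exists m.
Qed.

End finite_support.

(** * Almost everywhere convergence of orthogonal expansions *)

Section RademacherMenshov.
Context {R : realType}.
Implicit Types (a : nat -> R[i]).

(* Sum of the squared moduli of all the dyadic block sums of [a] in
   [s, s + 2^L[. *)
Fixpoint dyadic (L : nat) a (s : nat) : R :=
  match L with
  | 0 => sqmod (a s)
  | L'.+1 => sqmod (\sum_(i < 2 ^ L) a (s + i)%N) +
      (dyadic L' a s + dyadic L' a (s + 2 ^ L')%N)
  end.

Lemma dyadic_ge0 L a s : 0 <= dyadic L a s.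
Proof.
elim: L s => [|L IHL] s /=; first exact: sqmod_ge0.
by apply: addr_ge0; [exact: sqmod_ge0|exact: addr_ge0].
Qed.

Lemma dyadic_block L a s : sqmod (\sum_(i < 2 ^ L) a (s + i)%N) <= dyadic L a s.
Proof.
case: L => [|L] /=; first by rewrite expn0 big_ord1 addn0.
by rewrite lerDl; apply: addr_ge0; exact: dyadic_ge0.
Qed.

(** Young's inequality with weight [t], cleared of denominators. In [dyadic_prefix] the weight
    [L.+1] keeps the constant linear in the depth, where weight 1 would double it at each level. *)
Lemma sqmodD_weighted (t : R) (z w : R[i]) : 0 < t ->
  t * sqmod (z + w) <= (t + 1) * (t * sqmod z + sqmod w).
Proof.
case: z w => [x y] [x' y'] t0; rewrite /sqmod/=.
have := sqr_ge0 (t * x - x'); have := sqr_ge0 (t * y - y').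
nra.
Qed.

(** By binary expansion: a prefix reaching past the middle is the whole left block followed by a
    prefix of the right one, so at most one block per level is used. *)
Lemma dyadic_prefix L a s k : (k <= 2 ^ L)%N ->
  sqmod (\sum_(i < k) a (s + i)%N) <= L.+1%:R * dyadic L a s.
Proof.
elim: L s k => [|L IHL] s k.
  rewrite expn0 mul1r; case: k => [_|[|//] _]; last by rewrite big_ord1 addn0.
  by rewrite big_ord0 sqmod0 dyadic_ge0.
move=> k2; have B0 : 0 <= dyadic L a (s + 2 ^ L)%N by exact: dyadic_ge0.
have A0 : 0 <= dyadic L a s by exact: dyadic_ge0.
have C0 := sqmod_ge0 (\sum_(i < 2 ^ L.+1) a (s + i)%N).
have L0 : 0 <= L%:R :> R by exact: ler0n.
have [kL|kL] := leqP k (2 ^ L).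
  apply: le_trans (IHL s k kL) _; rewrite /= -!natr1; nra.
have -> : \sum_(i < k) a (s + i)%N = \sum_(i < 2 ^ L) a (s + i)%N +
    \sum_(i < k - 2 ^ L) a (s + 2 ^ L + i)%N.
  rewrite -(big_mkord xpredT (fun i => a (s + i)%N)) (@big_cat_nat _ _ _ (2 ^ L))//=; last exact: ltnW.
  rewrite big_mkord; congr (_ + _); rewrite -[X in \big[_/_]_(X <= _ < _) _]add0n big_addn.
  by rewrite big_mkord; apply: eq_bigr => i _; rewrite addnAC addnA.
have kL' : (k - 2 ^ L <= 2 ^ L)%N by rewrite leq_subLR addnn -mul2n -expnS.
have H1 := dyadic_block L a s; have H2 := IHL (s + 2 ^ L)%N _ kL'.
have := @sqmodD_weighted L.+1%:R (\sum_(i < 2 ^ L) a (s + i)%N)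
  (\sum_(i < k - 2 ^ L) a (s + 2 ^ L + i)%N) (ltr0Sn _ _).
set X := sqmod (_ + _); set Y := sqmod _ in H1 *; set Z := sqmod _ in H2 *.
move=> H.
have t0 : 0 < L.+1%:R :> R by [].
rewrite -(ler_pM2l t0); apply: le_trans H _.
rewrite [in leRHS]/= -/dyadic; set C := sqmod _ in C0 *.
apply: (@le_trans _ _ (L.+2%:R * (L.+1%:R * (dyadic L a s + dyadic L a (s + 2 ^ L)%N)))).
  rewrite natr1; apply: ler_wpM2l => //; rewrite [leRHS]mulrDr.
  by apply: lerD => //; exact: ler_wpM2l.
rewrite mulrCA; apply: ler_wpM2l => //; apply: ler_wpM2l => //.
by rewrite [leRHS]addrC lerDl.
Qed.

Context {n : nat} (D : set 'rV[R]_n).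
Hypothesis mD : measurable D.
Variable u : nat -> 'rV[R]_n -> R[i].
Hypothesis Lu : forall i, L2 D (u i).
Hypothesis ou : forall i j, i != j -> rip D (u i) (u j) = 0.

Lemma dyadic_measurable L s : measurable_fun D (fun x => dyadic L (u^~ x) s).
Proof.
elim: L s => [|L IHL] s /=.
  by apply/measurable_EFinP; exact: L2_sqmod_measurable.
apply: measurable_funD; last by apply: measurable_funD.
apply/measurable_EFinP.
apply: (L2_sqmod_measurable (u := fun x => \sum_(i < 2 ^ L.+1) u (s + i)%N x)).
exact: L2_sum.
Qed.

(** Each of the [L.+1] levels partitions the same [2 ^ L] terms, so by orthogonality each
    contributes the full sum of squared norms. *)
Lemma integral_dyadic L s :
  (\int[leb n]_(x in D) (dyadic L (u^~ x) s)%:E =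
   (L.+1%:R * \sum_(i < 2 ^ L) rip D (u (s + i)%N) (u (s + i)%N))%:E)%E.
Proof.
elim: L s => [|L IHL] s /=.
  by rewrite expn0 big_ord1 addn0 mul1r -sqnorm_rip.
have mL s' : measurable_fun D (fun x => (dyadic L (u^~ x) s')%:E).
  by apply/measurable_EFinP; exact: dyadic_measurable.
have Lb : L2 D (fun x => \sum_(i < 2 ^ L.+1) u (s + i)%N x) by exact: L2_sum.
have p0 L' s' x : D x -> (0 <= (dyadic L' (u^~ x) s')%:E)%E.
  by move=> _; rewrite lee_fin dyadic_ge0.
have b0 x : D x -> (0 <= (sqmod (\sum_(i < 2 ^ L.+1) u (s + i)%N x))%:E)%E.
  by move=> _; rewrite lee_fin sqmod_ge0.
transitivity (sqnorm D (fun x => \sum_(i < 2 ^ L.+1) u (s + i)%N x)%R +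
    (\int[leb n]_(x in D) (dyadic L (u^~ x) s)%:E +
     \int[leb n]_(x in D) (dyadic L (u^~ x) (s + 2 ^ L)%N)%:E))%E.
  have p2 x : D x -> (0 <= (dyadic L (u^~ x) s)%:E +
      (dyadic L (u^~ x) (s + 2 ^ L)%N)%:E)%E.
    by move=> Dx; apply: adde_ge0; exact: p0.
  rewrite -(ge0_integralD _ mD (p0 L s) (mL s) (p0 L (s + 2 ^ L)%N) (mL (s + 2 ^ L)%N)).
  rewrite /sqnorm -(ge0_integralD _ mD b0 (L2_sqmod_measurable Lb) p2
    (emeasurable_funD (mL s) (mL (s + 2 ^ L)%N))).
  by apply: eq_integral => x _; rewrite -!EFinD.
rewrite !IHL.
rewrite sqnorm_rip// rip_norm_sum//; last 2 first.
- by rewrite /index_enum -enumT enum_uniq.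
- by move=> i j _ _ ij; apply: ou; rewrite eqn_add2l.
rewrite -!EFinD; congr EFin.
have E : \sum_(i < 2 ^ L.+1) rip D (u (s + i)%N) (u (s + i)%N) =
    \sum_(i < 2 ^ L) rip D (u (s + i)%N) (u (s + i)%N) +
    \sum_(i < 2 ^ L) rip D (u (s + 2 ^ L + i)%N) (u (s + 2 ^ L + i)%N).
  rewrite -(big_mkord xpredT (fun i => rip D (u (s + i)%N) (u (s + i)%N))).
  rewrite (@big_cat_nat _ _ _ (2 ^ L))//=; last by rewrite leq_exp2l.
  rewrite big_mkord; congr (_ + _); rewrite -[X in \big[_/_]_(X <= _ < _) _]add0n big_addn.
  rewrite expnS mul2n -addnn addnK.
  by rewrite big_mkord; apply: eq_bigr => i _; rewrite addnAC addnA.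
by rewrite E -[L.+2%:R]natr1 -mulrDr mulrDl mul1r addrC.
Qed.

End RademacherMenshov.

(** * Maximal functions over doubly exponential ranges *)

Section orthogonal_expansion.
Context {R : realType} {n : nat}.
Local Notation fn := ('rV[R]_n -> R[i]).
Variables (D : set 'rV[R]_n) (Lam : set R) (f : fn) (e : R -> fn).
Hypothesis mD : measurable D.
Hypothesis Lf : L2 D f.
Hypothesis e_L2 : forall lam, Lam lam -> L2 D (e lam).
Hypothesis e_orth : forall lam lam', Lam lam -> Lam lam' -> lam != lam' ->
  rip D (e lam) (e lam') = 0.
Hypothesis e_coef : forall lam, Lam lam -> rip D f (e lam) = rip D (e lam) (e lam).

Lemma expansion_L2 (S : seq R) : {in S, forall lam, Lam lam} ->
  L2 D (fun x => \sum_(lam <- S) e lam x).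
Proof.
move=> SL; pose e' lam := if lam \in S then e lam else fun=> 0.
rewrite (_ : (fun _ => _) = fun x => \sum_(lam <- S) e' lam x).
  by apply: L2_sum => // lam; rewrite /e'; case: ifPn => [/SL/e_L2//|_]; exact: L2_0.
apply/funext => x; rewrite big_seq [RHS]big_seq; apply: eq_bigr => lam lS.
by rewrite /e' lS.
Qed.

Lemma expansion_norm (S : seq R) : uniq S -> {in S, forall lam, Lam lam} ->
  let g := fun x => f x - \sum_(lam <- S) e lam x in
  rip D g g = rip D f f - \sum_(lam <- S) rip D (e lam) (e lam).
Proof.
move=> uS SL g; pose e' lam := if lam \in S then e lam else fun=> 0.
have Le' lam : L2 D (e' lam).
  by rewrite /e'; case: ifPn => [/SL/e_L2//|_]; exact: L2_0.
pose s x := \sum_(lam <- S) e' lam x.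
have gE : g = fun x => f x - s x.
  apply/funext => x; congr (_ - _); rewrite /s big_seq [RHS]big_seq.
  by apply: eq_bigr => lam lS; rewrite /e' lS.
have Ls : L2 D s by exact: L2_sum.
have Lg := L2B mD Lf Ls.
have E : \sum_(lam <- S) rip D (e lam) (e lam) = \sum_(lam <- S) rip D (e' lam) (e' lam).
  by rewrite big_seq [RHS]big_seq; apply: eq_bigr => lam lS; rewrite /e' lS.
have ss : rip D s s = \sum_(lam <- S) rip D (e' lam) (e' lam).
  rewrite /s rip_norm_sum// => l l' lS lS' ll; rewrite /e' lS lS'.
  by apply: e_orth => //; exact: SL.
have fs : rip D f s = \sum_(lam <- S) rip D (e' lam) (e' lam).
  rewrite ripC /s rip_suml// big_seq [RHS]big_seq; apply: eq_bigr => lam lS.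
  by rewrite /e' lS ripC e_coef//; exact: SL.
by rewrite gE ripBl ?ripBr// (ripC D s f) fs ss E subrr subr0.
Qed.

(** Turns spectral cutoffs into prefixes of a list, the form in which [dyadic_prefix] applies. *)
Lemma filter_le_sorted (r : R) (s : seq R) : sorted <=%R s ->
  [seq x <- s | x <= r] = take (count (<= r) s) s.
Proof.
elim: s => //= a s IHs pas; have := IHs (path_sorted pas).
case: leP => [_ -> //|ra _].
have /allP sa := order_path_min le_trans pas.
rewrite add0n (_ : count _ _ = 0)%N ?take0.
  apply/eqP; rewrite -[_ == _]negbK -has_filter; apply/hasPn => x /sa ax.
  by rewrite -ltNge (lt_le_trans ra).
apply/eqP; rewrite -leqn0 leqNgt -has_count; apply/hasPn => x /sa ax.
by rewrite -ltNge (lt_le_trans ra).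
Qed.

Variables (K p : nat).
Hypothesis Lam_size : forall (s : seq R) (m : nat), (0 < m)%N -> uniq s ->
  {in s, forall lam, Lam lam /\ lam <= m%:R} -> (size s <= K * m ^ p)%N.
Variable nu : {measure set R -> \bar R}.
Hypothesis tail : forall (r : R) (S : seq R), uniq S ->
  (forall lam, Lam lam /\ lam <= r <-> lam \in S) ->
  (sqnorm D (fun x => f x - \sum_(lam <- S) e lam x)%R <= nu `]r, +oo[%classic)%E.
Hypothesis nu_log : (\int[nu]_lam (ln (2 + lam) ^+ 2)%:E < +oo)%E.

Let t (j : nat) : nat := (2 ^ (2 ^ j))%N.

(** Chosen so that [2 ^ L j] exceeds the bound [K * t j.+1 ^ p] on the number of terms up to
    [t j.+1]: [K <= 2 ^ K], and [t j.+1 ^ p = 2 ^ (p.*2 * 2 ^ j)]. *)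
Let L (j : nat) : nat := ((K + p.*2) * 2 ^ j)%N.

(** Only the [j] with [t j < lam] contribute, and a geometric sum is at most [4 / 3] of its last
    term [4 ^+ j]; for this [j], [ln 2 * 2 ^+ j] is [ln (t j)], which is below [ln (2 + lam)]. *)
Lemma log_weight_le (J : nat) (lam : R) :
  \sum_(j < J) 4 ^+ j * \1_(`](t j)%:R, +oo[%classic : set R) lam <=
  4 / 3 / ln 2 ^+ 2 * ln (2 + lam) ^+ 2.
Proof.
have l2 : 0 < ln 2 :> R by rewrite ln_gt0// ltr1n.
have c0 : 0 <= 4 / 3 / ln 2 ^+ 2 :> R by rewrite divr_ge0// exprn_ge0// ltW.
elim: J => [|J IHJ]; first by rewrite big_ord0; apply: mulr_ge0 => //; exact: sqr_ge0.
have geo m : 3 * \sum_(j < m) 4 ^+ j = 4 ^+ m - 1 :> R.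
  elim: m => [|m IHm]; first by rewrite big_ord0 mulr0 expr0 subrr.
  by rewrite big_ord_recr/= mulrDr IHm exprS; ring.
have [tJ|tJ] := ltP (t J)%:R lam; last first.
  rewrite big_ord_recr/= indicE memNset ?mulr0 ?addr0//=.
  by rewrite in_itv/= andbT; apply/negP; rewrite -leNgt.
apply: (@le_trans _ _ (4 / 3 * 4 ^+ J)).
  apply: (@le_trans _ _ (\sum_(j < J.+1) 4 ^+ j)).
    apply: ler_sum => j _; rewrite indicE; case: (_ \in _); rewrite ?mulr1// mulr0.
    exact: exprn_ge0.
  by have := geo J.+1; rewrite exprS => H; lra.
have t0 : 0 < (t J)%:R :> R by rewrite ltr0n expn_gt0.
have lt : ln 2 * 2 ^+ J <= ln (2 + lam).
  rewrite -natrX mulr_natr -lnXn// -natrX ler_ln ?posrE//; last by lra.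
  by rewrite /t in tJ; lra.
have l0 : 0 <= ln 2 * 2 ^+ J :> R by rewrite mulr_ge0// ?exprn_ge0// ltW.
have : (ln 2 * 2 ^+ J) ^+ 2 <= ln (2 + lam) ^+ 2.
  by rewrite ler_pXn2r ?nnegrE// (le_trans l0).
rewrite exprMn -exprM mulnC exprM (_ : 2 ^+ 2 = 4); last by rewrite expr2 -natrM.
move=> H; apply: (@le_trans _ _ (4 / 3 / ln 2 ^+ 2 * (ln 2 ^+ 2 * 4 ^+ J))).
  by rewrite mulrA divfK// expf_neq0// gt_eqF.
exact: ler_wpM2l.
Qed.

Lemma tail_weight_le (J : nat) :
  (\sum_(j < J) (4 ^+ j)%:E * nu `](t j)%:R, +oo[%classic <=
   (4 / 3 / ln 2 ^+ 2)%:E * \int[nu]_lam (ln (2 + lam) ^+ 2)%:E)%E.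
Proof.
have l2 : 0 < ln 2 :> R by rewrite ln_gt0// ltr1n.
have mt j : measurable (`](t j)%:R, +oo[%classic : set R) by exact: measurable_itv.
have mln : measurable_fun setT (fun lam : R => (ln (2 + lam) ^+ 2)%:E).
  apply/measurable_EFinP; apply: measurable_funX.
  by apply: measurableT_comp => //; exact: measurable_funD.
rewrite -ge0_integralZl//; last 2 first.
- by move=> x _; rewrite lee_fin sqr_ge0.
- by rewrite lee_fin divr_ge0// exprn_ge0// ltW.
apply: (@le_trans _ _ (\int[nu]_lam (\sum_(j < J) (4 ^+ j)%:E *
    (\1_(`](t j)%:R, +oo[%classic : set R) lam : R)%:E))%E).
  have mi j : measurable_fun setT
      (fun lam => (\1_(`](t j)%:R, +oo[%classic : set R) lam : R)%:E).
    exact/measurable_EFinP/measurable_indic.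
  have p4 j : (0 <= (4 ^+ j)%:E :> \bar R)%E by rewrite lee_fin exprn_ge0.
  have i0 j (lam : R) : (0 <= (\1_(`](t j)%:R, +oo[%classic : set R) lam : R)%:E)%E.
    by rewrite lee_fin.
  rewrite (ge0_integral_sum _ measurableT); last 2 first.
  - by move=> j; exact: measurable_funeM.
  - by move=> j x _; exact: mule_ge0.
  apply: lee_sum => j _.
  rewrite (ge0_integralZl _ measurableT (mi j) (fun x _ => i0 j x) (p4 j)).
  by rewrite integral_indic// setIT.
apply: ge0_le_integral => //.
- by move=> x _; apply: sume_ge0 => j _; rewrite mule_ge0// lee_fin exprn_ge0.
- apply: emeasurable_sum => j; apply: measurable_funeM.
  exact/measurable_EFinP/measurable_indic.
- by apply: measurable_funeM.
- move=> x _; under eq_bigr do rewrite -EFinM.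
  rewrite sumEFin -EFinM lee_fin; exact: log_weight_le.
Qed.

Lemma cutoff_seq (r : R) : exists2 S : seq R, uniq S /\ sorted <=%R S &
  forall lam, Lam lam /\ lam <= r <-> lam \in S.
Proof.
pose m := (Num.truncn r).+1.
have [s us sX] : exists2 S : seq R, uniq S &
    forall lam, [set lam | Lam lam /\ lam <= r] lam <-> lam \in S.
  apply: (@uniq_size_finite _ _ (K * m ^ p)) => s us sE.
  apply: Lam_size => // lam /sE[? lr]; split => //.
  by rewrite (le_trans lr)// ltW// truncnS_gt.
exists (sort <=%R s).
  by rewrite sort_uniq; split => //; exact: sort_le_sorted.
by move=> lam; rewrite mem_sort; exact: sX.
Qed.

(* On the doubly exponential range ]2^(2^j), 2^(2^(j+1))] the number of terms
   has logarithm O(2^j), so a single block costs O(4^j), which is comparable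
   with [ln (2 + lam) ^+ 2] on that range and sums geometrically in [j]. *)
Lemma block_majorant (j : nat) : exists H : 'rV[R]_n -> R,
  [/\ measurable_fun D H, forall x, 0 <= H x,
     forall x r, (t j)%:R <= r <= (t j.+1)%:R ->
       sqmod (f x - \sum_(lam \in [set lam | Lam lam /\ lam <= r]) e lam x) <= H x &
     (\int[leb n]_(x in D) (H x)%:E <=
       (2 + 2 * (L j).+1%:R ^+ 2)%:E * nu `](t j)%:R, +oo[%classic)%E].
Proof.
have [S [uS sS] SE] := cutoff_seq (t j)%:R.
have [T [uT sT] TE] := cutoff_seq (t j.+1)%:R.
have tt : (t j <= t j.+1)%N by rewrite leq_exp2l// leq_exp2l.
pose B := [seq x <- T | (t j)%:R < x].
have SL : {in S, forall lam, Lam lam} by move=> lam /SE[].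
have TL : {in T, forall lam, Lam lam} by move=> lam /TE[].
have BL : {in B, forall lam, Lam lam}.
  by move=> lam; rewrite mem_filter => /andP[_ /TL].
have uB : uniq B by exact: filter_uniq.
have sB : sorted <=%R B by apply: sorted_filter => //; exact: le_trans.
have SB : ~~ has [in S] B.
  apply/hasPn => lam; rewrite mem_filter => /andP[tl _].
  by apply/negP => /SE[_]; rewrite leNgt tl.
have sizeB : (size B <= 2 ^ L j)%N.
  rewrite size_filter; apply: leq_trans (count_size _ _) _.
  apply: (@leq_trans (K * t j.+1 ^ p)).
    apply: Lam_size => //; first by rewrite expn_gt0.
    by move=> lam /TE.
  rewrite /L mulnDl expnD; apply: leq_mul.
    apply: leq_trans (ltnW (ltn_expl K (leqnn 2))) _.
    by rewrite leq_exp2l// leq_pmulr// expn_gt0.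
  by rewrite /t -expnM leq_exp2l// expnS -muln2 mulnC mulnA.
(* The block is padded by zeros to a sequence, so that dyadic sums of length [2 ^ L j] make sense;
   orthogonality survives. *)
pose v (i : nat) : fn := if (i < size B)%N then e (nth 0 B i) else fun=> 0.
have Lv i : L2 D (v i).
  rewrite /v; case: ifP => iB; last exact: L2_0.
  by apply/e_L2/BL; exact: mem_nth.
have ov i k : i != k -> rip D (v i) (v k) = 0.
  move=> ik; rewrite /v; case: ifP => iB; last by rewrite rip0l.
  case: ifP => kB; last by rewrite ripC rip0l.
  by apply: e_orth; [exact/BL/mem_nth|exact/BL/mem_nth|rewrite nth_uniq].
have Lg : L2 D (fun x => f x - \sum_(lam <- S) e lam x).
  by apply: L2B => //; exact: expansion_L2.
(* The first term is the error at the left end [t j], the second the oscillation inside the range.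
   One factor [(L j).+1] comes from [dyadic_prefix], a second one from [integral_dyadic]. *)
exists (fun x => 2 * sqmod (f x - \sum_(lam <- S) e lam x) +
  2 * (L j).+1%:R * dyadic (L j) (v^~ x) 0); split.
- apply: measurable_funD; apply: measurable_funM => //.
    by apply/measurable_EFinP; exact: L2_sqmod_measurable Lg.
  exact: dyadic_measurable.
- move=> x; apply: addr_ge0; apply: mulr_ge0 => //; first exact: sqmod_ge0.
  exact: dyadic_ge0.
- move=> x r /andP[tr rt].
  have -> : \sum_(lam \in [set lam | Lam lam /\ lam <= r]) e lam x =
      \sum_(lam <- S) e lam x + \sum_(i < count (<= r) B) v i x.
    rewrite (_ : [set lam | _] = [set` S ++ [seq lam <- B | lam <= r]]); last first.
      apply/seteqP; split => lam /=; rewrite mem_cat !mem_filter.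
        move=> [Ll lr]; apply/orP; case: (leP lam (t j)%:R) => [lt|tl].
          by left; apply/SE.
        by right; rewrite lr /=; apply/TE; split => //; exact: le_trans rt.
      move=> /orP[/SE[Ll lt]|/and3P[lr tl /TL]//].
      by split => //; exact: le_trans tr.
    rewrite -fsbig_seq; last first.
      rewrite cat_uniq uS filter_uniq// andbT/=.
      by apply: contra SB => /hasP[lam]; rewrite mem_filter => /andP[_ lB] lS;
         apply/hasP; exists lam.
    rewrite big_cat/=; congr (_ + _); rewrite filter_le_sorted//.
    rewrite (big_nth 0) big_mkord size_takel ?count_size//.
    apply: eq_bigr => i _; rewrite nth_take//.
    by rewrite /v (leq_trans (ltn_ord i) (count_size _ _)).
  rewrite opprD addrA; apply: le_trans (sqmodD_le _ _) _; rewrite lerD2l sqmodN.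
  rewrite -mulrA ler_pM2l//.
  have := @dyadic_prefix R (L j) (v^~ x) 0 (count (<= r) B).
  by apply; rewrite (leq_trans (count_size _ _)).
- have mS : measurable_fun D (fun x => (sqmod (f x - \sum_(lam <- S) e lam x))%:E).
    exact: L2_sqmod_measurable Lg.
  have mY : measurable_fun D (fun x => (dyadic (L j) (v^~ x) 0)%:E).
    by apply/measurable_EFinP; exact: dyadic_measurable.
  under eq_integral do rewrite EFinD 2!EFinM.
  rewrite ge0_integralD//; last 4 first.
  + by move=> x _; rewrite mule_ge0// lee_fin sqmod_ge0.
  + exact: measurable_funeM.
  + by move=> x _; rewrite mule_ge0// lee_fin dyadic_ge0.
  + exact: measurable_funeM.
  rewrite ge0_integralZl//; last by move=> x _; rewrite lee_fin sqmod_ge0.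
  rewrite ge0_integralZl//; last by move=> x _; rewrite lee_fin dyadic_ge0.
  rewrite integral_dyadic// -[X in (_ * X + _)%E]/(sqnorm D _).
  have tl : (sqnorm D (fun x => f x - \sum_(lam <- S) e lam x)%R <=
      nu `](t j)%:R, +oo[%classic)%E by exact: tail.
  have vB : \sum_(i < 2 ^ L j) rip D (v (0 + i)%N) (v (0 + i)%N) =
      \sum_(lam <- B) rip D (e lam) (e lam).
    rewrite -(big_mkord xpredT (fun i => rip D (v (0 + i)%N) (v (0 + i)%N))).
    rewrite (@big_cat_nat _ _ _ (size B))//= [X in _ + X]big1_seq ?addr0; last first.
      move=> i /=; rewrite mem_index_iota => /andP[Bi _].
      by rewrite add0n /v ltnNge Bi/= rip0l.
    rewrite [RHS](big_nth 0) big_nat [RHS]big_nat; apply: eq_bigr => i /andP[_ iB].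
    by rewrite add0n /v iB.
  (* The sum is the drop of the squared error from [S] to [S ++ B], hence at most the error at
     [S]. *)
  have BT : ((\sum_(lam <- B) rip D (e lam) (e lam))%:E <=
      nu `](t j)%:R, +oo[%classic)%E.
    apply: le_trans tl; rewrite sqnorm_rip// lee_fin expansion_norm//.
    have := rip_ge0 D (fun x => f x - \sum_(lam <- S ++ B) e lam x).
    rewrite expansion_norm ?big_cat/=; last 2 first.
    + by rewrite cat_uniq uS uB andbT.
    + by move=> lam; rewrite mem_cat => /orP[/SL|/BL].
    lra.
  have L0 : 0 <= 2 * (L j).+1%:R ^+ 2 :> R by rewrite mulr_ge0// exprn_ge0.
  rewrite vB [(2 + _)%:E]EFinD [leRHS]ge0_muleDl ?lee_fin//.
  apply: leeD; first by rewrite lee_wpmul2l// lee_fin.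
  rewrite -EFinM (_ : 2 * _ * _ = 2 * (L j).+1%:R ^+ 2 *
    \sum_(lam <- B) rip D (e lam) (e lam)); last by ring.
  by rewrite EFinM lee_wpmul2l// lee_fin mulr_ge0// exprn_ge0.
Qed.

(** The sum of the majorants is integrable, so at almost every [x] it is finite and its terms tend
    to 0. As they bound the distance to [f] itself, the limit is identified at the same time. *)
Lemma expansion_cvg_ae : \forall x \ae leb n, D x -> forall eps : R, 0 < eps ->
  \forall r \near +oo,
    sqmod (f x - \sum_(lam \in [set lam | Lam lam /\ lam <= r]) e lam x) < eps.
Proof.
have [H HE] := choice block_majorant.
have mH j : measurable_fun D (fun x => (H j x)%:E).
  by apply/measurable_EFinP; have [] := HE j.
have H0 j x : 0 <= H j x by have [_ + _ _] := HE j; apply.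
pose F x := (\sum_(0 <= j <oo) (H j x)%:E)%E.
have mF : measurable_fun D F.
  by apply: ge0_emeasurable_sum => [j x _ _|j _ //]; rewrite lee_fin.
have F0 x : (0 <= F x)%E by apply: nneseries_ge0 => j _ _; rewrite lee_fin.
(* [q] absorbs the successor: [(L j).+1 <= q * 2 ^ j], so the constant of range [j] is at most
   [4 * q ^ 2 * 4 ^ j]. *)
pose q : nat := (K + p.*2).+1.
have LE j : 2 + 2 * (L j).+1%:R ^+ 2 <= (4 * q%:R ^+ 2) * 4 ^+ j :> R.
  have j1 : 1 <= 2 ^+ j :> R by rewrite exprn_ege1// ler1n.
  have Lq : (L j).+1%:R <= q%:R * 2 ^+ j :> R.
    rewrite -natrX -natrM ler_nat /q mulSn -addn1 addnC leq_add2r//.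
    by rewrite expn_gt0.
  have L1 : 1 <= (L j).+1%:R :> R by rewrite ler1n.
  have -> : 4 ^+ j = (2 ^+ j) ^+ 2 :> R.
    by rewrite -exprM mulnC exprM; congr (_ ^+ _); rewrite expr2 -natrM.
  have : (L j).+1%:R ^+ 2 <= (q%:R * 2 ^+ j) ^+ 2 :> R.
    by rewrite ler_pXn2r// nnegrE// (le_trans _ Lq).
  have : 1 <= (L j).+1%:R ^+ 2 :> R by rewrite exprn_ege1.
  rewrite exprMn -mulrA; set a := (L j).+1%:R ^+ 2; set b := q%:R ^+ 2 * _; lra.
have iF : (\int[leb n]_(x in D) F x < +oo)%E.
  rewrite integral_nneseries//; last by move=> j x _; rewrite lee_fin.
  pose W := (\int[nu]_lam (ln (2 + lam) ^+ 2)%:E)%E.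
  have l2 : 0 < ln 2 :> R by rewrite ln_gt0// ltr1n.
  apply: (@le_lt_trans _ _ ((4 * q%:R ^+ 2)%:E * ((4 / 3 / ln 2 ^+ 2)%:E * W))%E).
    apply: lime_le.
      by apply: is_cvg_nneseries => j _ _; apply: integral_ge0 => x _; rewrite lee_fin.
    apply: nearW => J; rewrite big_mkord.
    apply: (@le_trans _ _ (\sum_(j < J) (4 * q%:R ^+ 2)%:E *
        ((4 ^+ j)%:E * nu `](t j)%:R, +oo[%classic))%E).
      apply: lee_sum => j _; have [_ _ _ Hj] := HE j; apply: le_trans Hj _.
      by rewrite muleA -EFinM lee_wpmul2r// lee_fin.
    rewrite -ge0_sume_distrr; last first.
      by move=> j _; rewrite mule_ge0// lee_fin exprn_ge0.
    by rewrite lee_wpmul2l// ?tail_weight_le// lee_fin mulr_ge0// exprn_ge0.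
  have W0 : (0 <= W)%E.
    by apply: integral_ge0 => x _; rewrite lee_fin sqr_ge0.
  have Woo : W \is a fin_num by rewrite ge0_fin_numE.
  by rewrite -(fineK Woo) -!EFinM ltry.
have intF : (leb n).-integrable D F.
  apply/integrableP; split => //.
  by under eq_integral do rewrite gee0_abs//.
have := integrable_ae mD intF; apply: filterS => x Fx Dx eps e0.
have {}Fx := Fx Dx.
have Hcvg : H j x @[j --> \oo] --> 0.
  apply: cvg_series_cvg_0; apply: nondecreasing_is_cvgn.
    by apply/nondecreasing_seqP => j; rewrite seriesSr lerDl.
  exists (fine (F x)) => _ [j _ <-].
  rewrite -lee_fin fineK// /series/= -sumEFin.
  by apply: nneseries_lim_ge => i _ _; rewrite lee_fin.
have [j0 _ Hj0] := cvgr_lt _ Hcvg _ e0.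
near=> r.
have rj0 : (t j0)%:R <= r by near: r; exact: nbhs_pinfty_ge.
(* The range containing [r] is found from the first endpoint beyond [r]; it has index at least [j0]
   because [t j0 <= r]. *)
have [m [mj0 tm]] : exists m, (j0 <= m)%N /\ (t m)%:R <= r < (t m.+1)%:R.
  have ex : exists m, r < (t m)%:R.
    exists (Num.truncn r).+1; apply: lt_le_trans (truncnS_gt r) _.
    by rewrite ler_nat /t; do 2 (apply: leq_trans (ltnW (ltn_expl _ (leqnn 2))) _).
  have [m tm mmin] := ex_minnP ex.
  have j0m : (j0 < m)%N.
    rewrite ltnNge; apply/negP => mj.
    have : (t m)%:R <= (t j0)%:R :> R by rewrite ler_nat leq_exp2l// leq_exp2l.
    by move=> /le_trans/(_ rj0); rewrite leNgt tm.
  exists m.-1; case: m j0m tm mmin => // m j0m tm mmin; split => //=.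
  by rewrite tm andbT leNgt; apply/negP => /mmin; rewrite ltnn.
apply: le_lt_trans (Hj0 m mj0); have [_ _ + _] := HE m; apply.
by have /andP[-> /ltW ->] := tm.
Unshelve. all: by end_near. Qed.

End orthogonal_expansion.

(** * Spectral resolutions with polynomial eigenvalue counting *)

Section concentrated.
Context d (T : measurableType d) (R : realType) (nu : {measure set T -> \bar R}).
Variables (B : set T) (f : T -> R) (a b : R).
Hypotheses (mB : measurable B) (nuB : nu (~` B) = 0%E) (nuoo : (nu setT < +oo)%E).
Hypotheses (mf : measurable_fun setT f) (fab : forall x, B x -> a <= f x <= b).

Let nuBoo : (nu B < +oo)%E.
Proof. by apply: le_lt_trans nuoo; apply: le_measure; rewrite ?inE. Qed.

Let TB : [set: T] `\` ~` B = B.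
Proof. by rewrite setTD setCK. Qed.

Lemma bounded_integrable : nu.-integrable B (EFin \o f).
Proof.
apply: measurable_bounded_integrable => //; first exact: measurable_funTS.
exists (`|a| + `|b|); split; first exact: num_real.
move=> M aM x Bx /=; apply: le_trans (ltW aM); have := fab Bx.
have := ler_norm b; have := ler_norm (- a); rewrite normrN ler_norml.
have := normr_ge0 a; have := normr_ge0 b.
by move=> *; apply/andP; split; lra.
Qed.

Lemma concentrated_integrable : nu.-integrable setT (EFin \o f).
Proof.
apply/(negligible_integrable (measurableC mB)) => //.
- exact/measurable_EFinP.
- by rewrite TB; exact: bounded_integrable.
Qed.

Lemma concentrated_Rintegral :
  (\int[nu]_x f x = \int[nu]_(x in B) f x)%R.
Proof.
rewrite /Rintegral (negligible_integral (measurableC mB))//.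
- by rewrite TB.
- exact: concentrated_integrable.
Qed.

Lemma concentrated_bounds :
  a * fine (nu setT) <= (\int[nu]_x f x)%R <= b * fine (nu setT).
Proof.
have TBE : nu setT = nu B.
  have := measureU nu mB (measurableC mB) (setICr B).
  by rewrite setUv [X in (_ + X)%E]nuB adde0.
have ic c : nu.-integrable B (EFin \o (fun=> c)).
  apply/integrableP; split; first exact: measurable_cst.
  by rewrite integral_cst// lte_mul_pinfty// ?ge0_fin_numE.
rewrite concentrated_Rintegral TBE -!Rintegral_cst//.
by apply/andP; split; apply: le_Rintegral => //;
  try exact: bounded_integrable; move=> x /fab/andP[].
Qed.

End concentrated.

Section spectral.
Context {R : realType} {n : nat}.
Local Notation fn := ('rV[R]_n -> R[i]).
Implicit Types (u v w : fn) (B C : set R).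
Variables (Omega : set 'rV[R]_n) (A : fn -> fn -> Prop).
Hypothesis mO : measurable Omega.
Hypothesis A_L2 : forall u w, A u w -> L2 Omega u /\ L2 Omega w.
Hypothesis A_sym : forall u w v z, A u w -> A v z -> rip Omega w v = rip Omega u z.
Hypothesis A_ge0 : forall u w, A u w -> 0 <= rip Omega w u.
Hypothesis A_ae : forall u w w', A u w -> L2 Omega w' ->
  w = w' %[ae leb n in Omega] -> A u w'.
Variable E : spectral_resolution Omega A.
Local Notation P := (spec_proj E).
Local Notation mu := (spec_measure E).
Local Notation "<< u , v >>" := (rip Omega u v).
Local Notation L2 := (L2 Omega).
Local Notation I k := (`[- k%:R, k%:R]%classic : set R).

Lemma proj_L2 B u : measurable B -> L2 u -> L2 (P B u).
Proof. exact: spec_proj_L2. Qed.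
Hint Resolve proj_L2 : core.

Lemma proj_sym B u v : measurable B -> L2 u -> L2 v -> << P B u, v >> = << u, P B v >>.
Proof. by move=> mB Lu Lv; rewrite -!Re_inner (spec_proj_sym E mB Lu Lv). Qed.

(** Spectral identities hold almost everywhere only; tested against a vector [v] they become
    equations between reals that can be rewritten. *)
Lemma projI B C u v : measurable B -> measurable C -> L2 u -> L2 v ->
  << P B (P C u), v >> = << P (B `&` C) u, v >>.
Proof.
move=> mB mC Lu Lv; apply/esym; apply: rip_congr => //; last exact: spec_projI.
- by apply: proj_L2 => //; exact: measurableI.
- by apply: proj_L2 => //; exact: proj_L2.
Qed.

Lemma rip_proj2 B C u v : measurable B -> measurable C -> L2 u -> L2 v ->
  << P B u, P C v >> = << P (C `&` B) u, v >>.
Proof. by move=> mB mC Lu Lv; rewrite -proj_sym ?projI//; exact: proj_L2. Qed.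

Lemma spec_measure_rip B u : measurable B -> L2 u -> mu u B = (<< P B u, u >>)%:E.
Proof.
move=> mB Lu; rewrite spec_measureE// sqnorm_rip//; last exact: proj_L2.
by rewrite rip_proj2// setIid.
Qed.

Lemma proj_norm B u : measurable B -> L2 u -> << P B u, P B u >> = << P B u, u >>.
Proof. by move=> mB Lu; rewrite rip_proj2// setIid. Qed.

Lemma spec_measure_lty B u : measurable B -> L2 u -> (mu u B < +oo)%E.
Proof. by move=> mB Lu; rewrite spec_measure_rip// ltry. Qed.

Lemma proj_T u v : L2 u -> L2 v -> << P setT u, v >> = << u, v >>.
Proof.
move=> Lu Lv; apply: rip_congr => //; first exact: proj_L2.
exact: spec_projT.
Qed.

Lemma spec_measureT u : L2 u -> mu u setT = (<< u, u >>)%:E.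
Proof. by move=> Lu; rewrite spec_measure_rip// proj_T. Qed.

Lemma proj_eq0 B u v : measurable B -> L2 u -> L2 v -> mu u B = 0%E ->
  << P B u, v >> = 0.
Proof.
move=> mB Lu Lv; rewrite spec_measure_rip// => -[u0]; apply: rip_eq0l => //.
  exact: proj_L2.
by rewrite proj_norm.
Qed.

Lemma proj0 u v : L2 u -> L2 v -> << P set0 u, v >> = 0.
Proof. by move=> Lu Lv; apply: proj_eq0 => //; rewrite measure0. Qed.

Lemma proj_disjoint B C u v : measurable B -> measurable C -> L2 u -> L2 v ->
  B `&` C = set0 -> << P B u, P C v >> = 0.
Proof. by move=> mB mC Lu Lv BC; rewrite rip_proj2// setIC BC proj0. Qed.

(** Additivity of the projections is recovered from that of the measure [spec_measure u]: together
    with multiplicativity it makes the norm of the defect [d] vanish. *)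
Lemma projU B C u v : measurable B -> measurable C -> L2 u -> L2 v ->
  B `&` C = set0 -> << P (B `|` C) u, v >> = << P B u, v >> + << P C u, v >>.
Proof.
move=> mB mC Lu Lv BC; have mBC := measurableU _ _ mB mC.
have Lp := proj_L2 mBC Lu; have Lq := proj_L2 mB Lu; have Lr := proj_L2 mC Lu.
have Lqr := L2D mO Lq Lr.
have mE : << P (B `|` C) u, u >> = << P B u, u >> + << P C u, u >>.
  apply: EFin_inj; rewrite EFinD -!spec_measure_rip// measureU//.
pose d := fun x => P (B `|` C) u x - (P B u x + P C u x).
have d0 : << d, d >> = 0.
  rewrite /d ripBl ?ripBr ?ripDl ?ripDr//; try exact: L2B.
  rewrite !rip_proj2//.
  rewrite (setIC C B) BC !proj0// !setIid mE.
  have -> : B `&` (B `|` C) = B by rewrite setIUr setIid; apply/setUidPl => x [].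
  have -> : C `&` (B `|` C) = C by rewrite setIUr setIid; apply/setUidPr => x [].
  have -> : (B `|` C) `&` B = B by rewrite setIUl setIid; apply/setUidPl => x [].
  have -> : (B `|` C) `&` C = C by rewrite setIUl setIid; apply/setUidPr => x [].
  lra.
have := rip_eq0l mO (L2B mO Lp Lqr) Lv d0.
by rewrite ripBl// ripDl// => /eqP; rewrite subr_eq0 => /eqP.
Qed.

Lemma spec_measure_proj B C u : measurable B -> measurable C -> L2 u ->
  mu (P B u) C = mu u (C `&` B).
Proof.
move=> mB mC Lu; rewrite !spec_measure_rip//; last 2 first.
- exact: measurableI.
- exact: proj_L2.
congr EFin; rewrite projI//; last exact: proj_L2.
rewrite rip_proj2//; last exact: measurableI.
by rewrite (setIC B) -setIA setIid.
Qed.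

Lemma spec_measure_projC B u : measurable B -> L2 u -> mu (P B u) (~` B) = 0%E.
Proof.
by move=> mB Lu; rewrite spec_measure_proj//; [rewrite setICl measure0|exact: measurableC].
Qed.

(** The spectral measure of [P B u] is finite and concentrated on the bounded set [B], where the
    square is bounded. *)
Lemma proj_dom B u (k : nat) : measurable B -> B `<=` I k -> L2 u ->
  exists w, A (P B u) w.
Proof.
move=> mB Bk Lu; have Lp := proj_L2 mB Lu.
apply/(spec_domain E Lp).
have kB x : B x -> 0 <= x ^+ 2 <= k%:R ^+ 2.
  move=> /Bk /=; rewrite in_itv/= => xk; rewrite sqr_ge0/=.
  by rewrite -(real_normK (num_real x)) ler_pXn2r ?nnegrE// ler_norml.
have mf : measurable_fun [set: R] (fun x : R => x ^+ 2) by exact: measurable_funX.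
have /integrableP[_] := concentrated_integrable mB (spec_measure_projC mB Lu)
  (spec_measure_lty measurableT Lp) mf kB.
apply: le_lt_trans; rewrite le_eqVlt; apply/orP; left; apply/eqP.
by apply: eq_integral => x _ /=; rewrite ger0_norm// sqr_ge0.
Qed.

Definition quad u : R := (\int[mu u]_lam lam)%R.

Lemma quadE u w : A u w -> << w, u >> = quad u.
Proof. by move=> Auw; rewrite -Re_inner (spec_formE E Auw). Qed.

Lemma quad_bounds B u (a b : R) : measurable B -> (forall x, B x -> a <= x <= b) ->
  L2 u -> a * << P B u, P B u >> <= quad (P B u) <= b * << P B u, P B u >>.
Proof.
move=> mB Bab Lu; have Lp := proj_L2 mB Lu.
have := concentrated_bounds mB (spec_measure_projC mB Lu)
  (spec_measure_lty measurableT Lp) (@measurable_id _ _ setT) Bab.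
by rewrite spec_measureT.
Qed.

(** Replaces the measure of [P B u], which varies with [B], by the fixed measure of [u]; additivity
    in [B] then is that of the integral. *)
Lemma quadE_int B u (k : nat) : measurable B -> B `<=` I k -> L2 u ->
  quad (P B u) = (\int[mu u]_(lam in B) lam)%R.
Proof.
move=> mB Bk Lu; have Lp := proj_L2 mB Lu.
have Bab x : B x -> - k%:R <= x <= k%:R by move=> /Bk /=; rewrite in_itv.
rewrite /quad (concentrated_Rintegral mB (spec_measure_projC mB Lu)
  (spec_measure_lty measurableT Lp) (@measurable_id _ _ setT) Bab).
congr fine; apply: eq_measure_integral => X mX XB.
by rewrite spec_measure_proj//; congr (mu u _); apply/setIidPl.
Qed.

Lemma quadU B C u (k : nat) : measurable B -> measurable C -> B `&` C = set0 ->
  B `<=` I k -> C `<=` I k -> L2 u ->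
  quad (P (B `|` C) u) = quad (P B u) + quad (P C u).
Proof.
move=> mB mC BC Bk Ck Lu; have mBC := measurableU _ _ mB mC.
have BCk : B `|` C `<=` I k by move=> x [/Bk|/Ck].
rewrite (quadE_int mBC BCk Lu) (quadE_int mB Bk Lu) (quadE_int mC Ck Lu).
apply: Rintegral_setU => //; last by apply/disj_setPS => x; rewrite BC.
have Bab x : (B `|` C) x -> - k%:R <= x <= k%:R by move=> /BCk /=; rewrite in_itv.
apply: (bounded_integrable mBC _ _ Bab) => //.
exact: spec_measure_lty.
Qed.

(* [A] is only known through its quadratic form [quad], which is additive over
   disjoint spectral sets; expanding [quad] of a sum by symmetry shows that [A]
   maps the range of [P B] to the orthogonal of the range of [P C]. *)
Lemma quad_cross1 B C z w w' (k : nat) : measurable B -> measurable C ->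
  B `&` C = set0 -> B `<=` I k -> C `<=` I k -> L2 z ->
  A (P B z) w -> A (P C z) w' -> << w, P C z >> = 0.
Proof.
move=> mB mC BC Bk Ck Lz AB AC; have mBC := measurableU _ _ mB mC.
have [wx Ax] : exists w, A (P (B `|` C) z) w.
  by apply: (@proj_dom _ _ k) => // x [/Bk|/Ck].
have [[LB Lw] [LC Lw'] [Lx Lwx]] := And3 (A_L2 AB) (A_L2 AC) (A_L2 Ax).
have := quadU mB mC BC Bk Ck Lz.
rewrite -(quadE Ax) -(quadE AB) -(quadE AC).
rewrite ripC projU// (ripC _ _ wx) (ripC _ _ wx) (A_sym Ax AB) (A_sym Ax AC) !projU//.
rewrite -(A_sym AB AC) (ripC _ _ w) (ripC _ _ w) (ripC _ _ w').
lra.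
Qed.

(** Two vectors reduce to one: [P B] and [P C] recover their separate pieces from [z], the sum of
    [P B z1] and [P C z2]. *)
Lemma quad_cross B C z1 z2 w (k : nat) : measurable B -> measurable C ->
  B `&` C = set0 -> B `<=` I k -> C `<=` I k -> L2 z1 -> L2 z2 ->
  A (P B z1) w -> << w, P C z2 >> = 0.
Proof.
move=> mB mC BC Bk Ck L1 L2' AB; have [LB Lw] := A_L2 AB.
have LC := proj_L2 mC L2'; pose z x := P B z1 x + P C z2 x.
have Lz : L2 z by exact: L2D.
have PBz v : L2 v -> << P B z, v >> = << P B z1, v >>.
  move=> Lv; have Lpv := proj_L2 mB Lv.
  rewrite proj_sym// ripDl// rip_proj2// setIid rip_proj2// BC proj0//.
  by rewrite addr0.
have PCz v : L2 v -> << P C z, v >> = << P C z2, v >>.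
  move=> Lv; have Lpv := proj_L2 mC Lv.
  rewrite proj_sym// ripDl// rip_proj2// setIC BC proj0// rip_proj2//.
  by rewrite setIid add0r.
have [w' AB'] := proj_dom mB Bk Lz; have [w'' AC] := proj_dom mC Ck Lz.
have [[LB' Lw'] [LC' Lw'']] := (A_L2 AB', A_L2 AC).
(* [P B z] may replace [P B z1] only inside an inner product, not as an argument of [A]; symmetry
   first moves [A] to the other factor. *)
rewrite ripC -PCz// -(A_sym AC AB) ripC -PBz// -(A_sym AB' AC).
exact: (quad_cross1 mB mC BC Bk Ck Lz AB' AC).
Qed.

Lemma sub_itvn (lam : R) : exists k0 : nat, forall k, (k0 <= k)%N -> [set lam] `<=` I k.
Proof.
exists (Num.truncn `|lam|).+1 => k k0 _ -> /=; rewrite in_itv/= -ler_norml.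
by apply: le_trans (ltW (truncnS_gt _)) _; rewrite ler_nat.
Qed.

(** On a singleton the bounds of [quad_bounds] coincide, so the form is [lam] times the squared
    norm; polarization with [y + y'] gives the mixed values. *)
Lemma quad_polar (lam : R) y y' w : L2 y -> L2 y' -> A (P [set lam] y) w ->
  << w, P [set lam] y' >> = lam * << P [set lam] y, P [set lam] y' >>.
Proof.
move=> Ly Ly' Ap; have [k0 /(_ _ (leqnn k0)) sk] := sub_itvn lam.
have m1 : measurable [set lam] by exact: measurable_set1.
have lamE x : [set lam] x -> lam <= x <= lam by move=> ->; rewrite lexx.
have qE z : L2 z ->
    quad (P [set lam] z) = lam * << P [set lam] z, P [set lam] z >>.
  by move=> Lz; apply/eqP; rewrite eq_le andbC; exact: quad_bounds.
have Lz : L2 (fun x => y x + y' x) by exact: L2D.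
have [w' Ap'] := proj_dom m1 sk Ly'; have [wx Ax] := proj_dom m1 sk Lz.
have [[Lp Lw] [Lp' Lw'] [Lx Lwx]] := And3 (A_L2 Ap) (A_L2 Ap') (A_L2 Ax).
have PD v : L2 v -> << P [set lam] (fun x => y x + y' x), v >> =
    << P [set lam] y, v >> + << P [set lam] y', v >>.
  by move=> Lv; rewrite proj_sym// ripDl// ?proj_sym//; exact: proj_L2.
have := qE _ Lz; rewrite -(quadE Ax) ripC PD// PD//.
rewrite (ripC _ _ wx) (ripC _ _ wx) (A_sym Ax Ap) (A_sym Ax Ap') !PD//.
rewrite (ripC _ (P [set lam] y) (P [set lam] (fun x => y x + y' x))) PD// (ripC _ (P [set lam] y') (P [set lam] (fun x => y x + y' x))) PD//.
have := qE _ Ly; have := qE _ Ly'; rewrite -(quadE Ap) -(quadE Ap').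
rewrite -(A_sym Ap Ap') (ripC _ _ w) (ripC _ _ w) (ripC _ _ w') (ripC _ (P _ y') (P _ y)).
lra.
Qed.

Lemma spec_tail u (eps : R) : L2 u -> 0 < eps ->
  \forall k \near \oo, (mu u (~` I k) < eps%:E)%E.
Proof.
move=> Lu e0.
have mI k : measurable (~` I k) by apply: measurableC; exact: measurable_itv.
have : mu u (~` I k) @[k --> \oo] --> mu u (\bigcap_k ~` I k).
  apply: nonincreasing_cvg_mu => //.
  - exact: spec_measure_lty.
  - exact: bigcapT_measurable.
  - move=> i j ij; apply/subsetPset; apply: subsetC => x /=; rewrite !in_itv/=.
    rewrite -!ler_norml => /le_trans; apply; by rewrite ler_nat.
rewrite (_ : \bigcap_k _ = set0) ?measure0; last first.
  rewrite -subset0 => x Ix; have [k0 /(_ _ (leqnn k0)) sk] := sub_itvn x.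
  by apply: (Ix k0 Logic.I); exact: sk.
move=> /fine_cvgP[fin cv].
have lt0 := cvgr_lt _ cv _ e0; apply: filterS2 fin (lt0 _) => k f1 f2.
by rewrite -(fineK f1) lte_fin.
Qed.

(** The defect [d] is orthogonal to the range of [P [set lam]] by [quad_polar] and to that of [P C],
    with [C] the rest of [I k], by [quad_cross]. These lemmas concern bounded sets, so a component
    on the complement of [I k] remains; it vanishes in the limit. *)
Lemma proj_set1_eigen (lam : R) y : L2 y ->
  A (P [set lam] y) (rscale lam (P [set lam] y)).
Proof.
move=> Ly; have [k0 sk] := sub_itvn lam.
have m1 : measurable [set lam] by exact: measurable_set1.
have [w Ap] := proj_dom m1 (sk _ (leqnn k0)) Ly.
have [Lp Lw] := A_L2 Ap; have LZ := L2Z mO lam Lp.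
apply: (A_ae Ap) => //; pose d x := w x - rscale lam (P [set lam] y) x.
have Ld : L2 d by exact: L2B.
suff d0 : << d, d >> = 0.
  have := rip_eq0 mO Ld d0; apply: filterS => x /= H Ox.
  by apply/eqP; rewrite -subr_eq0; apply/eqP/H.
have tail k : (k0 <= k)%N -> << d, d >> = << d, P (~` I k) d >>.
  move=> kk; pose C := I k `\ lam.
  have mIk : measurable (I k) by exact: measurable_itv.
  have mC : measurable C by exact: measurableD.
  have lC : [set lam] `&` C = set0 by rewrite setIC setDKI.
  have lCE : [set lam] `|` C = I k by rewrite /C setDUK//; exact: sk.
  have mCI : measurable (~` I k) by exact: measurableC.
  rewrite -{1}proj_T// -(setUv (I k)) projU//; last by rewrite setICr.
  rewrite -lCE projU// lCE.
  rewrite (ripC _ _ d) (ripC _ _ d) (ripC _ _ d) /d.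
  have Lp1 := proj_L2 m1 Ld; have Lp2 := proj_L2 mC Ld.
  rewrite [X in X + _ + _]ripBl// ripZl// (quad_polar Ly Ld Ap) subrr add0r.
  rewrite [X in X + _]ripBl// ripZl//.
  rewrite (quad_cross m1 mC lC _ _ Ly Ld Ap (k := k)).
  - by rewrite proj_disjoint// mulr0 subrr add0r.
  - exact: sk.
  - by move=> x [].
(* If [d] were nonzero, [spec_tail] would make its squared norm outside [I k] smaller than that of
   [d], while Cauchy-Schwarz applied to [tail] gives the reverse inequality. *)
apply/eqP; rewrite eq_le rip_ge0 andbT leNgt; apply/negP => dp.
have [N _ /(_ (maxn k0 N))] := spec_tail Ld dp.
move=> /(_ (leq_maxr _ _)); set k := maxn k0 N.
have mI : measurable (~` I k) by apply: measurableC; exact: measurable_itv.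
rewrite spec_measure_rip// -proj_norm// lte_fin ltNge => /negP; apply.
have := rip_CauchySchwarz mO Ld (proj_L2 mI Ld).
by rewrite -tail ?leq_maxl// expr2 ler_pM2l.
Qed.

Lemma eigen_ge0 (lam : R) u : A u (rscale lam u) -> 0 < << u, u >> -> 0 <= lam.
Proof.
move=> Au u0; have [Lu _] := A_L2 Au.
by have := A_ge0 Au; rewrite ripZl// pmulr_lge0.
Qed.

Lemma eigen_orthogonal (lam lam' : R) u v : A u (rscale lam u) ->
  A v (rscale lam' v) -> lam != lam' -> << u, v >> = 0.
Proof.
move=> Au Av ll; have [[Lu _] [Lv _]] := (A_L2 Au, A_L2 Av).
have := A_sym Au Av; rewrite ripZl// ripZr// => /eqP.
by rewrite -subr_eq0 -mulrBl mulf_eq0 subr_eq0 (negPf ll) => /eqP.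
Qed.

Lemma eigenvalueP (lam : R) :
  op_eigenvalue Omega A lam <-> exists2 u, A u (rscale lam u) & 0 < << u, u >>.
Proof.
split=> [[u Au u0]|[u Au u0]]; exists u => //; have [Lu _] := A_L2 Au.
  rewrite lt_def rip_ge0 andbT; apply/eqP => uu; apply: u0; exact: rip_eq0.
by move=> /(ae_eq_rip_eq0 mO Lu) uu; rewrite uu ltxx in u0.
Qed.

Lemma atom_eigenvalue (lam : R) u : L2 u -> mu u [set lam] != 0%E ->
  op_eigenvalue Omega A lam /\ 0 <= lam.
Proof.
move=> Lu; have m1 : measurable [set lam] by exact: measurable_set1.
rewrite spec_measure_rip// => u0; have Ap := proj_set1_eigen lam Lu.
have p0 : 0 < << P [set lam] u, P [set lam] u >>.
  by rewrite lt_def rip_ge0 andbT proj_norm.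
split; last exact: eigen_ge0 Ap p0.
by apply/eigenvalueP; exists (P [set lam] u).
Qed.

(** * Discreteness of the spectral measures *)

Variable K : nat.
Hypothesis A_size : forall (J : eqType) (s : seq J)
    (u w : J -> fn) (m : nat), (0 < m)%N -> uniq s ->
  {in s, forall i, A (u i) (w i)} ->
  {in s, forall i, 0 < << u i, u i >>} ->
  {in s, forall i, << w i, u i >> <= m%:R * << u i, u i >>} ->
  {in s &, forall i j, i != j -> << u i, u j >> = 0} ->
  (size s <= K * m ^ n)%N.

Local Notation eig r := [set lam | op_eigenvalue Omega A lam /\ 0 <= lam <= r].

Lemma eigenvalues_size_le (s : seq R) (m : nat) : (0 < m)%N -> uniq s ->
  {in s, forall lam, eig m%:R lam} -> (size s <= K * m ^ n)%N.
Proof.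
move=> m0 us sE.
have H lam : exists u, lam \in s -> A u (rscale lam u) /\ 0 < << u, u >>.
  have [ls|] := boolP (lam \in s); last by exists (fun=> 0).
  by have [/eigenvalueP[u Au u0] _] := sE lam ls; exists u.
have [u uE] := choice H.
apply: (@A_size _ s u (fun lam => rscale lam (u lam))) => //.
- by move=> lam /uE[].
- by move=> lam /uE[].
- move=> lam ls; have [Au u0] := uE lam ls; have [_ /andP[_ lm]] := sE lam ls.
  by have [Lu _] := A_L2 Au; rewrite ripZl// ler_wpM2r// ltW.
- move=> l l' ls ls' ll; have [[Au _] [Av _]] := (uE l ls, uE l' ls').
  exact: eigen_orthogonal Au Av ll.
Qed.

(** The counted vectors are the pieces [P (B x) u]: disjoint spectral sets make them orthogonal,
    charged ones nonzero, and [I k] bounds their energy. *)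
Lemma spec_support u (k : nat) : L2 u ->
  exists S : seq R, (mu u).-negligible (I k `\` [set` S]).
Proof.
move=> Lu; have mI : measurable (I k) by exact: measurable_itv.
(* [A_size] wants a positive energy bound, hence [k.+1]. *)
apply: (@finite_support _ _ _ (K * k.+1 ^ n)) => // s B us sB dB.
have H x : exists w, x \in s -> A (P (B x) u) w.
  have [xs|] := boolP (x \in s); last by exists (fun=> 0).
  have [mB Bk _] := sB x xs; have [w Aw] := proj_dom mB Bk Lu.
  by exists w.
have [w wE] := choice H.
apply: (@A_size _ s (fun x => P (B x) u) w) => //.
- move=> x xs; have [mB Bk B0] := sB x xs.
  rewrite lt_def rip_ge0 andbT proj_norm//; move: B0; apply: contra => /eqP B0.
  by rewrite spec_measure_rip// B0.
- move=> x xs; have [mB Bk B0] := sB x xs; rewrite (quadE (wE x xs)).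
  have Bab y : B x y -> - k.+1%:R <= y <= k.+1%:R.
    move=> /Bk /=; rewrite in_itv/= -!ler_norml => /le_trans; apply.
    by rewrite ler_nat.
  by have /andP[] := quad_bounds mB Bab Lu.
- move=> x y xs ys xy; have [[mB _ _] [mB' _ _]] := (sB x xs, sB y ys).
  by rewrite proj_disjoint// dB.
Qed.

(** On each [I k] the measure sits on a finite set, whose points up to [r] outside [S] are no atoms:
    an atom is a nonnegative eigenvalue and would belong to [S]. *)
Lemma spec_measure_eigenvalues u (r : R) (S : seq R) : L2 u ->
  (forall lam, eig r lam <-> lam \in S) ->
  mu u (`]-oo, r]%classic `\` [set` S]) = 0%E.
Proof.
move=> Lu SE.
have H k := spec_support k Lu; have [T TE] := choice H.
pose Z k := (I k `\` [set` T k]) `|`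
  [set` [seq x <- T k | (x <= r) && (x \notin S)]].
have Z0 k : (mu u).-negligible (Z k).
  apply: negligibleU; first exact: TE.
  apply: null_seq => x; rewrite mem_filter => /andP[/andP[xr xS] _].
  apply/eqP; apply: contraNT xS => /(atom_eigenvalue Lu)[ex x0].
  by apply/SE; split => //; rewrite x0.
have mS : measurable (`]-oo, r]%classic `\` [set` S]).
  by apply: measurableD; [exact: measurable_itv|exact: measurable_seq].
apply/(negligibleP _ mS); apply: negligibleS (negligible_bigcup Z0).
move=> x [/=]; rewrite in_itv/= => xr xS.
have [k0 /(_ _ (leqnn k0) _ (erefl x)) xk] := sub_itvn x.
exists k0 => //; have [xT|xT] := boolP (x \in T k0).
  right; rewrite /= mem_filter xT xr andbT /=; exact/negP.
by left; split => //; exact/negP.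
Qed.

(** * Projections onto the eigenspaces and the spectral tail *)

Variables (f : fn) (e : R -> fn).
Hypothesis Lf : L2 f.
Hypothesis e_proj : forall lam, op_eigenvalue Omega A lam ->
  is_orthogonal_projection Omega (op_eigenspace A lam) f (e lam).

Lemma e_eigen lam : op_eigenvalue Omega A lam -> A (e lam) (rscale lam (e lam)).
Proof. by move=> /e_proj[]. Qed.

Lemma e_L2 lam : op_eigenvalue Omega A lam -> L2 (e lam).
Proof. by move=> /e_eigen/A_L2[]. Qed.

Lemma e_rip lam v : op_eigenvalue Omega A lam -> A v (rscale lam v) ->
  << f, v >> = << e lam, v >>.
Proof.
move=> El Av; have [Lv _] := A_L2 Av; have Le := e_L2 El.
have [_ /(_ v Av)] := e_proj El => /(congr1 (@complex.Re R)).
by rewrite Re_inner ripBl// => /eqP; rewrite subr_eq0 => /eqP.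
Qed.

(** [P [set lam] f] lies in the eigenspace, so it has the same inner product with [f] as with
    [e lam]; Cauchy-Schwarz concludes. *)
Lemma e_norm_ge lam : op_eigenvalue Omega A lam ->
  (mu f [set lam] <= (<< e lam, e lam >>)%:E)%E.
Proof.
move=> El; have Le := e_L2 El; have Ap := proj_set1_eigen lam Lf.
have m1 : measurable [set lam] by exact: measurable_set1.
have Lp := proj_L2 m1 Lf.
rewrite spec_measure_rip// lee_fin -proj_norm//.
have pE : << P [set lam] f, P [set lam] f >> = << e lam, P [set lam] f >>.
  by rewrite proj_norm// ripC (e_rip El Ap).
have := rip_CauchySchwarz mO Le Lp; rewrite -pE expr2.
have := rip_ge0 Omega (P [set lam] f); rewrite le_eqVlt => /predU1P[<- _|p0].
  exact: rip_ge0.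
by rewrite ler_pM2r.
Qed.

Let Lam := [set lam | op_eigenvalue Omega A lam /\ 0 <= lam].

Let Lam_L2 lam : Lam lam -> L2 (e lam). Proof. by move=> [/e_L2]. Qed.

Let Lam_orth lam lam' : Lam lam -> Lam lam' -> lam != lam' ->
  << e lam, e lam' >> = 0.
Proof. by move=> [/e_eigen Al _] [/e_eigen Al' _]; exact: eigen_orthogonal Al Al'. Qed.

Let Lam_coef lam : Lam lam -> << f, e lam >> = << e lam, e lam >>.
Proof. by move=> [El _]; rewrite (e_rip El (e_eigen El)). Qed.

(** The squared error is the total mass of [mu f] minus the squared norms of the [e lam]. These
    dominate the atoms in [S], which carry all the mass up to [r]. *)
Lemma partial_sum_tail (r : R) (S : seq R) : uniq S ->
  (forall lam, eig r lam <-> lam \in S) ->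
  (sqnorm Omega (fun x => f x - \sum_(lam <- S) e lam x)%R <= mu f `]r, +oo[%classic)%E.
Proof.
move=> uS SE; have SL : {in S, forall lam, Lam lam}.
  by move=> lam /SE[El /andP[l0 _]]; split.
have Lg := L2B mO Lf (expansion_L2 mO Lam_L2 SL).
rewrite sqnorm_rip// (expansion_norm mO Lf Lam_L2 Lam_orth Lam_coef uS SL).
have mr : measurable (`]-oo, r]%classic : set R) by exact: measurable_itv.
have mr' : measurable (`]r, +oo[%classic : set R) by exact: measurable_itv.
have TE : (<< f, f >>)%:E = (mu f `]-oo, r]%classic + mu f `]r, +oo[%classic)%E.
  rewrite -spec_measureT// -measureU//.
    by congr (mu f _); apply/seteqP; split => x //= _; rewrite !in_itv/= andbT;
       case: (leP x r); [left|right].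
  rewrite -subset0 => x []/=; rewrite !in_itv/= andbT => h1 h2.
  by have := lt_le_trans h2 h1; rewrite ltxx.
rewrite EFinB TE leeBlDr// addeC leeD2l//.
have mS := @measurable_seq R S.
apply: (@le_trans _ _ (mu f (`]-oo, r]%classic `\` [set` S]) + mu f [set` S])%E).
  apply: le_trans (measureU2 _ _ _) => //; last exact: measurableD.
  apply: le_measure; rewrite ?inE//; first by apply: measurableU => //; exact: measurableD.
  by move=> x xr; case: (boolP (x \in S)) => xS; [right|left; split=> //; exact/negP].
rewrite spec_measure_eigenvalues// add0e.
apply: le_trans (measure_seq_le _ _) _; rewrite -sumEFin big_seq [leRHS]big_seq.
by apply: lee_sum => lam /SL[El _]; exact: e_norm_ge.
Qed.

Lemma partial_sum_cvg_ae :
  (\int[mu f]_lam (ln (2 + lam) ^+ 2)%:E < +oo)%E ->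
  \forall x \ae leb n, Omega x -> forall eps : R, 0 < eps ->
    \forall r \near +oo, sqmod (f x - partial_sum Omega A e r x) < eps.
Proof.
move=> f_log; have eigE r : eig r = [set lam | Lam lam /\ lam <= r].
  apply/seteqP; split => lam /=; first by move=> [El /andP[l0 lr]]; split=> //; split.
  by move=> [[El l0] lr]; split=> //; rewrite l0.
have Lsize (s : seq R) (m : nat) : (0 < m)%N -> uniq s ->
    {in s, forall lam, Lam lam /\ lam <= m%:R} -> (size s <= K * m ^ n)%N.
  move=> m0 us sE; apply: eigenvalues_size_le => // lam ls.
  by have := sE lam ls; rewrite eigE.
have tail r (S : seq R) : uniq S -> (forall lam, Lam lam /\ lam <= r <-> lam \in S) ->
    (sqnorm Omega (fun x => f x - \sum_(lam <- S) e lam x)%R <= mu f `]r, +oo[%classic)%E.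
  move=> uS SE; apply: partial_sum_tail => // lam.
  by have := SE lam; rewrite eigE.
have := expansion_cvg_ae mO Lf Lam_L2 Lam_orth Lam_coef Lsize tail f_log.
apply: filterS => x H Ox eps e0; apply: filterS (H Ox eps e0) => r.
by rewrite /partial_sum eigE.
Qed.

End spectral.

(** * Pointwise convergence for the Dirichlet operator *)

Theorem proposition5p1 (R : realType) (n : nat) (Omega : set 'rV[R]_n)
    (g : 'rV[R]_n -> 'M[R]_n)
    (Omega_open : open Omega) (Omega_connected : connected Omega)
    (Omega_bounded : bounded_set Omega)
    (Omega_smooth : smooth_boundary Omega)
    (g_smooth : forall j k, smooth_on_closure Omega (fun x => g x j k))
    (g_sym : forall x, closure Omega x -> (g x)^T = g x)
    (g_pos : forall x, closure Omega x -> forall xi : 'rV[R]_n, xi != 0 ->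
      0 < (xi *m g x *m xi^T) ord0 ord0)
    (E : spectral_resolution Omega (dirichlet_operator Omega g))
    (f : 'rV[R]_n -> R[i])
    (f_log : calculus_domain E (fun lam => ln (2 + lam)) f)
    (e : R -> 'rV[R]_n -> R[i])
    (e_proj : forall lam, op_eigenvalue Omega (dirichlet_operator Omega g) lam ->
      is_orthogonal_projection Omega
        (op_eigenspace (dirichlet_operator Omega g) lam) f (e lam)) :
  \forall x \ae leb n, Omega x ->
    (fun r => partial_sum Omega (dirichlet_operator Omega g) e r x : R[i]^o)
      @ +oo --> (f x : R[i]^o).
Proof.
have mO := open_measurable_rV Omega_open.
have [K A_size] := dirichlet_size_le Omega_open Omega_bounded g_smooth g_pos.
have [Lf flog] := f_log.
have A_L2 := @dirichlet_L2 R n Omega g.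
have A_sym := @dirichlet_sym R n Omega g g_sym.
have A_ge0 := dirichlet_ge0 Omega_open Omega_bounded g_smooth g_pos.
have A_ae := @dirichlet_ae R n Omega g Omega_open.
have := partial_sum_cvg_ae mO A_L2 A_sym A_ge0 A_ae A_size Lf e_proj flog.
apply: filterS => x H Ox; apply/cvgrPdist_lt => eps.
(* Here [eps] is a complex number; positivity in [R[i]] makes its imaginary part 0, and the squared
   moduli are compared with the square of its real part. *)
rewrite ltcE => /andP[/eqP/= eps_im eps0].
have eps2 : 0 < complex.Re eps ^+ 2 by rewrite exprn_gt0.
apply: filterS (H Ox _ eps2) => r; set z := f x - _ => zlt.
rewrite [X in X < _]normc_def ltcE/= eps_im eqxx/=.
by rewrite -ltr_sqr ?nnegrE ?sqrtr_ge0 ?ltW// sqr_sqrtr//; exact: sqmod_ge0.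
Qed.
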